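(* Let $P,P'\subset\mathbb{R}^n$ be aperiodic Delone sets of finite local complexity. Let $\Phi:\Omega_P\to\Omega_{P'}$ be a homeomorphism which maps $\Xi_P$ onto $\Xi_{P'}$ and satisfies $\Phi(P)=P'$. Let $\varphi_P:\mathbb{R}^n\to\mathbb{R}^n$ be the function determined by $\Phi(P-x)=P'-\varphi_P(x)$ for all $x\in\mathbb{R}^n$. Then there exists a smooth function $\varphi:\mathbb{R}^n\to\mathbb{R}^n$ with strongly $P$-equivariant differential $d\varphi$, which coincides with $\varphi_P$ on $P$, such that $\varphi(P)=P'$ and such that for all $r>0$ there exists $r'>0$ such that for all $x\in\mathbb{R}^n$: $B(\varphi(x),r)\cap\varphi(P)\subset\varphi(B(x,r')\cap P)$.
   Context: $B(x,r)$ is the open ball in $\mathbb{R}^n$ and, for a closed set $P\subset\mathbb{R}^n$, $B_r[P]=B(0,r)\cap P$. $P$ is uniformly discrete if $\inf\{|x-y| : x\neq y\in P\}>0$, relatively dense if there is $r$ such that $B_r[P-x]\ne\emptyset$ for all $x\in\mathbb{R}^n$, and Delone if both. $P$ has finite local complexity if for every $r$ there are only finitely many distinct sets $B_r[P-x]$, $x\in P$. $P$ is aperiodic if $P-h=P$ implies $h=0$. On closed subsets of $\mathbb{R}^n$ put $D(P,Q)=\inf\{\epsilon>0 : d_H(B_{1/\epsilon}[P]\cup\partial B(0,1/\epsilon),\,B_{1/\epsilon}[Q]\cup\partial B(0,1/\epsilon))\le\epsilon\}$, $d_H$ being the Hausdorff distance. $\Omega_P$ is the completion of $\mathrm{orb}(P)=\{P-x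 : x\in\mathbb{R}^n\}$ with respect to $D$ (a compact space), and $\Xi_P\subset\Omega_P$ (the canonical transversal) is the closure of $\{P-p : p\in P\}$. The orbits of the translation action are the path-connected components of the hulls, so $\Phi$ maps $\mathrm{orb}(P)$ into $\mathrm{orb}(P')$; since $P'$ is aperiodic, $\varphi_P(x)$ is uniquely determined. A function $f$ on $\mathbb{R}^n$ is strongly $P$-equivariant if there is a finite $R$ such that for all $x,y\in\mathbb{R}^n$, $B_R[P-x]=B_R[P-y]$ implies $f(x)=f(y)$. The differential $d\varphi$ is viewed as a function on $\mathbb{R}^n$ with values in linear maps. *)

(* Defs.v *)
From HB Require Import structures.
From mathcomp Require Import all_boot all_order all_algebra.
From mathcomp Require Import all_classical all_reals all_analysis.

Set Implicit Arguments.
Unset Strict Implicit.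
Unset Printing Implicit Defensive.

Import Order.TTheory GRing.Theory Num.Theory.
Import numFieldNormedType.Exports.

Local Open Scope classical_set_scope.
Local Open Scope ring_scope.

(* R^n is 'rV[R]_n.  The norm the library puts on 'rV[R]_n is the sup norm,
   whereas all balls and distances here are Euclidean; the two norms induce the
   same topology, hence the same continuity and differentiability. *)
Definition euclid_norm (R : realType) (n : nat) (x : 'rV[R]_n) : R :=
  Num.sqrt (\sum_i x 0 i ^+ 2).

Definition euclid_ball (R : realType) (n : nat) (x : 'rV[R]_n) (r : R)
  : set 'rV[R]_n := [set y | euclid_norm (y - x) < r].

(* For r > 0 this is the boundary of euclid_ball 0 r. *)
Definition euclid_sphere (R : realType) (n : nat) (r : R) : set 'rV[R]_n :=
  [set y | euclid_norm y = r].

(* P - x *)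
Definition translate (R : realType) (n : nat) (P : set 'rV[R]_n) (x : 'rV[R]_n)
  : set 'rV[R]_n := [set p - x | p in P].

(* B_r[P] *)
Definition ball_patch (R : realType) (n : nat) (r : R) (P : set 'rV[R]_n)
  : set 'rV[R]_n := euclid_ball 0 r `&` P.

(* The infimum is taken in the extended reals, so that it is +oo, and the
   condition holds, when P has at most one point. *)
Definition uniformly_discrete (R : realType) (n : nat) (P : set 'rV[R]_n) :=
  (0 < ereal_inf [set z | exists x y, [/\ P x, P y, x <> y
                                       & z = (euclid_norm (x - y))%:E]])%E.

Definition relatively_dense (R : realType) (n : nat) (P : set 'rV[R]_n) :=
  exists r : R, forall x, ball_patch r (translate P x) !=set0.

Definition Delone (R : realType) (n : nat) (P : set 'rV[R]_n) :=
  uniformly_discrete P /\ relatively_dense P.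

Definition finite_local_complexity (R : realType) (n : nat)
    (P : set 'rV[R]_n) :=
  forall r : R, finite_set [set ball_patch r (translate P x) | x in P].

Definition aperiodic (R : realType) (n : nat) (P : set 'rV[R]_n) :=
  forall h, translate P h = P -> h = 0.

Definition dist_to_set (R : realType) (n : nat) (x : 'rV[R]_n)
    (A : set 'rV[R]_n) : \bar R :=
  ereal_inf [set (euclid_norm (x - a))%:E | a in A].

Definition hausdorff_dist (R : realType) (n : nat) (A B : set 'rV[R]_n)
  : \bar R :=
  maxe (ereal_sup [set dist_to_set a B | a in A])
       (ereal_sup [set dist_to_set b A | b in B]).

(* D(P, Q).  The infimum is over a nonempty set: if n > 0, two subsets of the
   closed ball of radius 1/e containing its boundary are at Hausdorff distance
   at most 2/e, so every e >= sqrt 2 qualifies; if n = 0 the boundary is empty,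
   and any e qualifies for the only pair of translates of a nonempty set. *)
Definition pattern_dist (R : realType) (n : nat) (P Q : set 'rV[R]_n) : R :=
  inf [set e : R | 0 < e /\
    (hausdorff_dist (ball_patch e^-1 P `|` euclid_sphere e^-1)
                    (ball_patch e^-1 Q `|` euclid_sphere e^-1) <= e%:E)%E].

Definition orb (R : realType) (n : nat) (P : set 'rV[R]_n)
  : set (set 'rV[R]_n) := range (translate P).

(* The metric space Om, with the map i (whose values outside X are irrelevant),
   is a completion of the set X with respect to the distance d.  Completions
   are unique up to a unique isometry compatible with the maps i. *)
Definition is_completion (R : realType) (T : Type) (X : set T)
    (d : T -> T -> R) (Om : metricType R) (i : T -> Om) :=
  [/\ forall F : set_system Om, ProperFilter F -> cauchy F ->
        exists l : Om, F --> l,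
      forall x y, X x -> X y -> mdist (i x) (i y) = d x y
    & dense (i @` X)].

(* (Om, i) is the hull of P, the inclusion of orb P in it being i. *)
Definition is_hull (R : realType) (n : nat) (P : set 'rV[R]_n)
    (Om : metricType R) (i : set 'rV[R]_n -> Om) :=
  is_completion (orb P) (@pattern_dist R n) i.

(* Canonical transversal Xi_P. *)
Definition transversal_of (R : realType) (n : nat) (P : set 'rV[R]_n)
    (Om : metricType R) (i : set 'rV[R]_n -> Om) : set Om :=
  closure [set i (translate P p) | p in P].

Definition homeomorphism (T U : topologicalType) (f : T -> U) :=
  continuous f /\
  exists g : U -> T, [/\ cancel f g, cancel g f & continuous g].

(* The domain being finite-dimensional, the differential is C^k as a map into
   linear maps iff it is C^k when evaluated at each fixed vector v. *)
Fixpoint class_C (R : realType) (n : nat) (W : normedModType R) (k : nat)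
    (f : 'rV[R]_n -> W) : Prop :=
  match k with
  | 0 => continuous f
  | k'.+1 => (forall x, differentiable f x) /\
             forall v, class_C k' (fun x => 'd f x v)
  end.

Definition smooth (R : realType) (n : nat) (W : normedModType R)
    (f : 'rV[R]_n -> W) := forall k, class_C k f.

Definition strongly_equivariant (R : realType) (n : nat) (P : set 'rV[R]_n)
    (T : Type) (f : 'rV[R]_n -> T) :=
  exists r : R, forall x y,
    ball_patch r (translate P x) = ball_patch r (translate P y) -> f x = f y.

(* Main.v *)
Require Import Defs.
From HB Require Import structures.
From mathcomp Require Import all_boot all_order all_algebra.
From mathcomp Require Import all_classical all_reals all_analysis.
From mathcomp Require Import finmap ring lra.
Set Implicit Arguments.
Unset Strict Implicit.
Unset Printing Implicit Defensive.
Import Order.TTheory GRing.Theory Num.Theory.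
Import numFieldNormedType.Exports.
Local Open Scope classical_set_scope.
Local Open Scope ring_scope.

(** A pattern of finite local complexity is rigid in two ways.  Two of its
    translates that are close in the hull have, near the origin, the same patch
    up to a small translation ([hull_dist_match], [hull_dist_patch]); and a small
    non-zero translation of a pattern is visible in the hull ([hull_dist_gap]).

    Locally the hull is thus a ball of translations times a totally disconnected
    set of patterns, and a path in it that starts in the orbit of [P'] stays in
    this orbit and lifts to a path of translation vectors ([orbit_lift]).
    Applied to [t |-> Phi (P - t x)] this makes [phiP] uniformly continuous;
    applied to the inverse of [Phi] it shows that this inverse maps the orbit of
    [P'] to the orbit of [P], which gives an inverse [g] of [phiP] that is
    Lipschitz at large scale ([hull_cocycle_inverse]).  As [Phi] matches the
    transversals, [phiP] maps [P] onto [P'] ([hull_cocycle_image]).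

    The hull of [P] is compact ([hull_compact]), so [Phi] is uniformly
    continuous: if the patches of [P] at two of its points [p], [p1] agree in a
    large ball, then [Phi (P - p - t v)] and [Phi (P - p1 - t v)] remain close
    while [t] runs from [0] to [1].  The displacements [phiP (p + t v) - phiP p]
    and [phiP (p1 + t v) - phiP p1] start both at [0] and, by the gap, cannot
    separate.  Hence the displacement between two points of [P] is determined by
    a patch of fixed radius ([hull_cocycle_local]).

    The function [phi] is a weighted mean of the values of [phiP] at the points
    of [P] near [x], with smooth weights that depend on a patch at [x] only, have
    sum [1], and at a point of [P] charge this point alone.  A change of patch
    by an equal one adds a constant to [phi], so that the differential is
    strongly equivariant ([interpolation_equivariant]).  Finally [phi] stays at
    bounded distance from [phiP] ([interpolation_near]), and the last claim
    follows from the large scale Lipschitz property of [g]. *)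

(** * Euclidean norm and the distance between patterns *)

Section EuclideanNorm.
Context {R : realType} {n : nat}.
Implicit Types (x y : 'rV[R]_n) (k : R).

Lemma euclid_norm_ge0 x : 0 <= euclid_norm x.
Proof. exact: sqrtr_ge0. Qed.

Lemma sum_sqr_ge0 x : 0 <= \sum_j x 0 j ^+ 2.
Proof. by apply: sumr_ge0 => j _; apply: sqr_ge0. Qed.

Lemma sqr_euclid_norm x : euclid_norm x ^+ 2 = \sum_j x 0 j ^+ 2.
Proof. by rewrite sqr_sqrtr // sum_sqr_ge0. Qed.

Lemma euclid_normN x : euclid_norm (- x) = euclid_norm x.
Proof.
by rewrite /euclid_norm; congr Num.sqrt; apply: eq_bigr => j _; rewrite mxE sqrrN.
Qed.

Lemma euclid_distC x y : euclid_norm (x - y) = euclid_norm (y - x).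
Proof. by rewrite -euclid_normN opprB. Qed.

Lemma euclid_norm0 : euclid_norm (0 : 'rV[R]_n) = 0.
Proof.
by rewrite /euclid_norm big1 ?sqrtr0 // => j _; rewrite mxE expr0n.
Qed.

Lemma euclid_normZ k x : euclid_norm (k *: x) = `|k| * euclid_norm x.
Proof.
rewrite /euclid_norm -sqrtr_sqr -sqrtrM ?sqr_ge0 // mulr_sumr.
by congr Num.sqrt; apply: eq_bigr => j _; rewrite mxE exprMn.
Qed.

Lemma normr_le_euclid x : `|x| <= euclid_norm x.
Proof.
rewrite [leLHS]/Num.norm /= mx_normrE; apply/bigmax_leP; split=> [|[a j] _ /=].
  exact: euclid_norm_ge0.
rewrite -sqrtr_sqr ler_sqrt ?sum_sqr_ge0 // (ord1 a) (bigD1 j) //= lerDl.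
by apply: sumr_ge0 => ? _; apply: sqr_ge0.
Qed.

Lemma coord_le_normr x j : `|x 0 j| <= `|x|.
Proof.
by rewrite [leRHS]/Num.norm /= mx_normrE;
  apply: (le_bigmax _ (fun a : 'I_1 * 'I_n => `|x a.1 a.2|) (0, j)).
Qed.

Lemma euclid_le_normr x : euclid_norm x <= n.+1%:R * `|x|.
Proof.
have n0 : (0 : R) <= n.+1%:R * `|x| by rewrite mulr_ge0 ?ler0n.
rewrite -(ger0_norm n0) -sqrtr_sqr ler_sqrt ?sqr_ge0 //.
apply: (@le_trans _ _ (\sum_(j < n) `|x| ^+ 2)).
  apply: ler_sum => j _; rewrite -real_normK ?num_real //.
  by rewrite ler_sqr ?nnegrE ?normr_ge0 // coord_le_normr.
rewrite sumr_const card_ord -[leLHS]mulr_natl exprMn; apply: ler_wpM2r; first exact: sqr_ge0.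
by rewrite -natrX ler_nat (leq_trans (leqnSn n)) // expnS expn1 leq_pmulr.
Qed.

(** Expand the sum of the squares of [|y| x_j - |x| y_j], which is nonnegative. *)
Lemma cauchy_schwarz x y :
  \sum_j x 0 j * y 0 j <= euclid_norm x * euclid_norm y.
Proof.
set d := \sum_j _; set a := euclid_norm x; set b := euclid_norm y.
have a0 : 0 <= a := euclid_norm_ge0 x.
have b0 : 0 <= b := euclid_norm_ge0 y.
have key : 0 <= a ^+ 2 * b ^+ 2 * 2 - d * (a * b) * 2.
  have -> : a ^+ 2 * b ^+ 2 * 2 - d * (a * b) * 2
            = \sum_j (b * x 0 j - a * y 0 j) ^+ 2.
    transitivity (\sum_j (b ^+ 2 * x 0 j ^+ 2 + a ^+ 2 * y 0 j ^+ 2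
                          - (2 * a * b) * (x 0 j * y 0 j))).
      rewrite sumrB big_split /= -!mulr_sumr -!sqr_euclid_norm -/a -/b -/d.
      ring.
    by apply: eq_bigr => j _; ring.
  by apply: sumr_ge0 => j _; apply: sqr_ge0.
have [ab0|ab0] := eqVneq (a * b) 0; last first.
  have abp : 0 < a * b by rewrite lt_neqAle eq_sym ab0 mulr_ge0.
  rewrite -(ler_pM2r abp); nra.
rewrite ab0; move/eqP: ab0; rewrite mulf_eq0.
suff z (u v : 'rV[R]_n) : euclid_norm u == 0 -> \sum_j u 0 j * v 0 j <= 0.
  case/orP => h0; first exact: z.
  by rewrite /d; under eq_bigr do rewrite mulrC; exact: z.
move=> /eqP u0; rewrite big1 // => j _.
have : `|u 0 j| <= 0 by rewrite (le_trans (coord_le_normr u j)) // -u0 normr_le_euclid.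
by rewrite normr_le0 => /eqP ->; rewrite mul0r.
Qed.

Lemma ler_euclid_normD x y : euclid_norm (x + y) <= euclid_norm x + euclid_norm y.
Proof.
have h0 : 0 <= euclid_norm x + euclid_norm y by rewrite addr_ge0 ?euclid_norm_ge0.
rewrite -ler_sqr ?nnegrE ?euclid_norm_ge0 // sqr_euclid_norm.
have -> : \sum_j (x + y) 0 j ^+ 2
   = \sum_j x 0 j ^+ 2 + (\sum_j x 0 j * y 0 j) * 2 + \sum_j y 0 j ^+ 2.
  rewrite mulr_suml -!big_split /=; apply: eq_bigr => j _; rewrite mxE; ring.
rewrite -!sqr_euclid_norm; have := cauchy_schwarz x y; nra.
Qed.

Lemma ler_euclid_dist_sub x y : euclid_norm x - euclid_norm y <= euclid_norm (x - y).
Proof. by rewrite lerBlDr -{1}(subrK y x); exact: ler_euclid_normD. Qed.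

End EuclideanNorm.

Section PatternDistance.
Context {R : realType} {n : nat}.
Implicit Types (A B P Q : set 'rV[R]_n) (x y h v : 'rV[R]_n) (e r : R).

Lemma dist_to_set_le A a b : A b -> (dist_to_set a A <= (euclid_norm (a - b))%:E)%E.
Proof. by move=> Ab; apply: ereal_inf_lbound; exists b. Qed.

Lemma dist_to_set_lt A a e : (dist_to_set a A < e%:E)%E ->
  exists2 b, A b & euclid_norm (a - b) < e.
Proof.
by case/ereal_inf_lt => _ [b Ab <-]; rewrite lte_fin; exists b.
Qed.

Lemma hausdorff_dist_le A B e :
  (forall a, A a -> exists2 b, B b & euclid_norm (a - b) <= e) ->
  (forall b, B b -> exists2 a, A a & euclid_norm (b - a) <= e) ->
  (hausdorff_dist A B <= e%:E)%E.
Proof.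
move=> AB BA; rewrite /hausdorff_dist ge_max; apply/andP; split.
  apply: ge_ereal_sup => _ [a Aa <-]; have [b Bb ab] := AB _ Aa.
  by rewrite (le_trans (dist_to_set_le _ Bb)) // lee_fin.
apply: ge_ereal_sup => _ [b Bb <-]; have [a Aa ab] := BA _ Bb.
by rewrite (le_trans (dist_to_set_le _ Aa)) // lee_fin.
Qed.

Lemma hausdorff_dist_ltP A B e e' : (hausdorff_dist A B <= e%:E)%E -> e < e' ->
  forall a, A a -> exists2 b, B b & euclid_norm (a - b) < e'.
Proof.
rewrite /hausdorff_dist ge_max => /andP[AB _] ee' a Aa.
apply: dist_to_set_lt; apply: (le_lt_trans _ (_ : e%:E < _)%E); last by rewrite lte_fin.
by rewrite (le_trans _ AB) //; apply: ereal_sup_ubound; exists a.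
Qed.

Lemma pattern_dist_le P Q e : 0 < e ->
  (hausdorff_dist (ball_patch e^-1 P `|` euclid_sphere e^-1)
                  (ball_patch e^-1 Q `|` euclid_sphere e^-1) <= e%:E)%E ->
  pattern_dist P Q <= e.
Proof.
move=> e0 h; apply: ge_inf; last by split.
by exists 0 => t [/ltW].
Qed.

(** If the infimum were over the empty set it would be [0] by convention, and
    [pattern_dist P Q < e] would carry no information. *)
Lemma pattern_dist_ltP P Q e : P !=set0 -> Q !=set0 -> pattern_dist P Q < e ->
  exists2 e', 0 < e' < e &
   (hausdorff_dist (ball_patch e'^-1 P `|` euclid_sphere e'^-1)
                   (ball_patch e'^-1 Q `|` euclid_sphere e'^-1) <= e'%:E)%E.
Proof.
move=> P0 Q0; rewrite /pattern_dist; set S := (X in inf X) => h.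
suff S0 : S !=set0.
  by case: (inf_lt S0 h) => e' [e'0 he'] ?; exists e' => //; rewrite e'0.
have mem (Z : set 'rV[R]_n) : Z !=set0 ->
    exists b : 'rV[R]_n, (ball_patch 2^-1 Z `|` euclid_sphere 2^-1) b.
  move=> [z Zz]; have [z0|z0] := eqVneq (euclid_norm z) 0.
    by exists z; left; split => //; rewrite /euclid_ball /= subr0 z0 invr_gt0.
  exists ((2 * euclid_norm z)^-1 *: z); right; rewrite /euclid_sphere /=.
  rewrite euclid_normZ ger0_norm ?invr_ge0 ?mulr_ge0 ?euclid_norm_ge0 //.
  by rewrite invfM mulrAC -mulrA mulfV // mulr1.
have small (Z : set 'rV[R]_n) b :
    (ball_patch 2^-1 Z `|` euclid_sphere 2^-1) b -> euclid_norm b <= 2^-1.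
  by case=> [[]|]; rewrite /euclid_ball /euclid_sphere /= ?subr0; [move/ltW|move->].
have near a b : euclid_norm a <= 2^-1 -> euclid_norm b <= 2^-1 ->
    euclid_norm (a - b) <= (2 : R).
  move=> ha hb; rewrite (le_trans (ler_euclid_normD _ _)) // euclid_normN; lra.
exists 2; split => //; apply: hausdorff_dist_le => a /small ha.
  by have [b Bb] := mem _ Q0; exists b => //; apply: near => //; apply: small Bb.
by have [b Bb] := mem _ P0; exists b => //; apply: near => //; apply: small Bb.
Qed.

(** The spheres in the definition could provide the point close to [a]; the bound
    on [a] keeps it away from them. *)
Lemma pattern_dist_match P Q e a : P !=set0 -> Q !=set0 -> pattern_dist P Q < e ->
  P a -> euclid_norm a + e <= e^-1 ->
  exists2 b, Q b & euclid_norm (a - b) < e.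
Proof.
move=> P0 Q0 /(pattern_dist_ltP P0 Q0)[e' /andP[e'0 e'e] h] Pa ae.
have ie : e^-1 < e'^-1 by rewrite ltf_pV2 // posrE // (lt_trans e'0).
have a0 := euclid_norm_ge0 a.
have aA : (ball_patch e'^-1 P `|` euclid_sphere e'^-1) a.
  by left; split => //; rewrite /euclid_ball /= subr0; lra.
have [b [[_ Qb]|bS] ab] := hausdorff_dist_ltP h e'e aA; first by exists b.
move: bS; rewrite /euclid_sphere /= => bS.
have := ler_euclid_dist_sub b a; rewrite euclid_distC bS; lra.
Qed.

(** Patches that agree in a ball are at Hausdorff distance [0] there, so the only
    cost is the radius at which the comparison is made. *)
Lemma pattern_dist_agree P Q r : 0 < r ->
  (forall v, euclid_norm v < r -> (P v <-> Q v)) -> pattern_dist P Q <= r^-1.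
Proof.
move=> r0 PQ; apply: pattern_dist_le; rewrite ?invr_gt0 // invrK.
have -> : ball_patch r P = ball_patch r Q.
  apply/seteqP; split=> v [] hv Zv; split => //.
    by apply/PQ => //; move: hv; rewrite /euclid_ball /= subr0.
  by apply/PQ => //; move: hv; rewrite /euclid_ball /= subr0.
by apply: hausdorff_dist_le => a Aa; exists a => //; rewrite subrr euclid_norm0 invr_ge0 ltW.
Qed.

(** A point leaving the ball under the shift by [h] is within [|h|] of the
    sphere: this is what the spheres in the definition are for. *)
Lemma pattern_dist_shift P Q h e : 0 < e < 1 -> euclid_norm h < e ->
  (forall v, P v <-> Q (v - h)) -> pattern_dist P Q <= e.
Proof.
move=> /andP[e0 e1] he PQ; apply: pattern_dist_le => //.
have ie : e < e^-1 by rewrite (lt_trans e1) // invf_gt1.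
suff key (P1 Q1 : set 'rV[R]_n) k : euclid_norm k < e ->
    (forall v, P1 v -> Q1 (v - k)) ->
    forall a, (ball_patch e^-1 P1 `|` euclid_sphere e^-1) a ->
    exists2 b, (ball_patch e^-1 Q1 `|` euclid_sphere e^-1) b &
      euclid_norm (a - b) <= e.
  apply: hausdorff_dist_le; first by apply: (key _ _ h) => // v /PQ.
  apply: (key _ _ (- h)); rewrite ?euclid_normN // => v Qv.
  by apply/PQ; rewrite opprK addrK.
move=> ke PQ1 a [[ha Pa]|aS]; last first.
  by exists a; [right|rewrite subrr euclid_norm0 ltW].
move: ha; rewrite /euclid_ball /= subr0 => ha.
have [ak|ak] := ltP (euclid_norm (a - k)) e^-1.
  exists (a - k); first by left; split; [rewrite /euclid_ball /= subr0|exact: PQ1].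
  by rewrite opprB addrC subrK ltW.
have ak' : euclid_norm a >= e^-1 - euclid_norm k.
  by have := ler_euclid_normD a (- k); rewrite euclid_normN; lra.
have a0 : 0 < euclid_norm a by lra.
exists ((e^-1 / euclid_norm a) *: a).
  right; rewrite /euclid_sphere /= euclid_normZ ger0_norm; last first.
    by rewrite divr_ge0 // ?invr_ge0 ltW.
  by rewrite divfK // gt_eqF.
rewrite -{1}[a]scale1r -scalerBl euclid_normZ.
have -> : 1 - e^-1 / euclid_norm a = (euclid_norm a - e^-1) / euclid_norm a.
  by rewrite mulrBl divff // gt_eqF.
rewrite normrM (gtr0_norm (_ : 0 < (euclid_norm a)^-1)) ?invr_gt0 //.
rewrite divfK ?gt_eqF // ltr0_norm; lra.
Qed.

End PatternDistance.

(** * Delone sets and their patches *)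

Ltac vring := apply/rowP => ?; rewrite !mxE; ring.

Lemma pos_le2 {R : realType} (a b : R) : 0 < a -> 0 < b ->
  exists e : R, [/\ 0 < e, e <= a & e <= b].
Proof.
move=> a0 b0; exists (Num.min a b).
by split; rewrite ?lt_min ?a0 // ge_min lexx ?orbT.
Qed.

Section Finiteness.

Lemma finite_pos_lbound {R : realType} {T : choiceType} (A : set T) (f : T -> R) :
  finite_set A -> (forall a, A a -> 0 < f a) ->
  exists2 e : R, 0 < e & forall a, A a -> e <= f a.
Proof.
move=> /finite_seqP[s ->]; elim: s => [|a s IH] fpos; first by exists 1.
have [b bs|e e0 he] := IH; first by apply: fpos; rewrite /= inE bs orbT.
exists (Num.min e (f a)) => [|b /=].
  by rewrite lt_min e0 fpos //= mem_head.
by rewrite inE => /orP[/eqP->|/he h]; rewrite ge_min ?lexx ?orbT ?h.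
Qed.

Lemma ultra_finite_cover {T : Type} {U : choiceType} (F : set_system T) (A : set U)
    (B : U -> set T) : UltraFilter F -> finite_set A ->
  F [set t | exists2 u, A u & B u t] -> exists2 u, A u & F (B u).
Proof.
move=> FU /finite_seqP[s ->]; elim: s => [|a s IH] FB.
  by have [t [u]] := filter_ex FB.
have [Fa|Fa] := in_ultra_setVsetC (B a) FU; first by exists a; rewrite /= ?mem_head.
have [|u us Fu] := IH; last by exists u => //=; rewrite inE (us : u \in s) orbT.
apply: filterS (filterI FB Fa) => t [[u]] /=.
by rewrite inE => /orP[/eqP->//|us But] _; exists u.
Qed.

Context {R : realType} {n : nat}.
Implicit Types (A : set 'rV[R]_n).

Lemma compact_normr_le (K : R) : compact [set x : 'rV[R]_n | `|x| <= K].
Proof.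
apply: bounded_closed_compact.
  by exists K; split; [exact: num_real|move=> M KM x /= xK; exact: le_trans xK (ltW KM)].
rewrite (_ : [set x | _] = (fun x : 'rV[R]_n => `|x|) @^-1` [set y : R | y <= K]) //.
by apply: preimage_closed; [move=> x _; exact: norm_continuous|exact: closed_le].
Qed.

(** Cover the bounded region by finitely many balls of radius [s / 2]: each
    contains at most one point of a set with separation [s]. *)
Lemma separated_bounded_finite A (s K : R) : 0 < s ->
  (forall p q, A p -> A q -> `|p - q| < s -> p = q) ->
  (forall p, A p -> `|p| <= K) -> finite_set A.
Proof.
move=> s0 sep AK.
have := @compact_normr_le K; rewrite compact_cover.
move=> /(_ _ [set x : 'rV[R]_n | `|x| <= K] (fun x => ball x (s / 2))).
case=> [x _|x xK|D _ DK].
- exact: ball_open.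
- by exists x => //; apply: ballxx; rewrite divr_gt0.
suff fin : finite_set (\bigcup_(c in [set` D]) (A `&` ball c (s / 2))).
  apply: sub_finite_set fin => p Ap; have [c cD cp] := DK _ (AK _ Ap).
  by exists c.
apply: bigcup_finite => [|c _]; first exact: finite_fset.
have [->//|/set0P[p [Ap cp]]] := eqVneq (A `&` ball c (s / 2)) set0.
apply: sub_finite_set (finite_set1 p) => q [Aq cq] /=.
apply: sep => //; move: cp cq; rewrite -!ball_normE /= => cp cq.
by rewrite (le_lt_trans (ler_distD c _ _)) // distrC; lra.
Qed.

End Finiteness.

Section Delone.
Context {R : realType} {n : nat}.
Implicit Types (P : set 'rV[R]_n) (x y z p q v h : 'rV[R]_n).

Lemma translateE P x v : translate P x v <-> P (x + v).
Proof.
split=> [[p Pp <-]|Pv]; first by rewrite addrC subrK.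
by exists (x + v) => //; rewrite addrC addKr.
Qed.

Lemma translate0 P : translate P 0 = P.
Proof. by apply/seteqP; split=> v; rewrite translateE add0r. Qed.

(** From here on distances are measured in the sup norm, which defines the
    topology of ['rV_n]; only the constants change. *)
Lemma uniformly_discrete_sep P : uniformly_discrete P ->
  exists2 s : R, 0 < s & forall p q, P p -> P q -> `|p - q| < s -> p = q.
Proof.
rewrite /uniformly_discrete; set S := (X in ereal_inf X) => S0.
have [e e0 eS] : exists2 e : R, 0 < e & (e%:E <= ereal_inf S)%E.
  by case: (ereal_inf S) S0 => // [e e0|_]; [exists e|exists 1; rewrite ?leey].
exists (e / n.+1%:R) => [|p q Pp Pq pq]; first by rewrite divr_gt0.
apply: contrapT => npq; move: pq; rewrite ltr_pdivlMr // mulrC ltNge => /negP; apply.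
rewrite (le_trans _ (euclid_le_normr _)) // -lee_fin (le_trans eS) //.
by apply: ereal_inf_lbound; exists p, q.
Qed.

Lemma relatively_dense_near P : relatively_dense P ->
  exists2 r : R, 0 < r & forall x, exists2 p, P p & `|p - x| < r.
Proof.
move=> [r hr]; exists (Num.max r 1); first by rewrite lt_max ltr01 orbT.
move=> x; have [v [hv /translateE Pv]] := hr x; exists (x + v) => //.
move: hv; rewrite /euclid_ball /= subr0 addrAC subrr add0r => hv.
by rewrite lt_max (le_lt_trans (normr_le_euclid _) hv).
Qed.

(** Equality of patches with sup norm balls in place of the Euclidean ones, which
    costs the factor [n.+1%:R] of [patch_agree]. *)
Definition agree P (r : R) x y := forall v, `|v| < r -> (P (x + v) <-> P (y + v)).

Lemma agree_sym P r x y : agree P r x y -> agree P r y x.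
Proof. by move=> xy v vr; split=> /(xy _ vr). Qed.

Lemma agree_trans P r x y z : agree P r x y -> agree P r y z -> agree P r x z.
Proof. by move=> xy yz v vr; split=> [/(xy _ vr)/(yz _ vr)|/(yz _ vr)/(xy _ vr)]. Qed.

Lemma agree_le P r r' x y : r <= r' -> agree P r' x y -> agree P r x y.
Proof. by move=> rr' xy v vr; apply: xy; exact: lt_le_trans rr'. Qed.

Lemma agree_shift P r k x y h : agree P (r + k) x y -> `|h| <= k ->
  agree P r (x + h) (y + h).
Proof.
move=> xy hk v vr; rewrite -!addrA; apply: xy.
by rewrite (le_lt_trans (ler_normD _ _)) //; lra.
Qed.

Lemma patch_agree P r x y :
  ball_patch (n.+1%:R * r) (translate P x) = ball_patch (n.+1%:R * r) (translate P y) ->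
  agree P r x y.
Proof.
move=> /seteqP[xy yx] v vr.
have bv : euclid_ball 0 (n.+1%:R * r) v.
  rewrite /euclid_ball /= subr0 (le_lt_trans (euclid_le_normr v)) //.
  by rewrite ltr_pM2l ?ltr0n.
split=> Pv; apply/translateE.
  by have [] := xy v (conj bv (iffRL (translateE P x v) Pv)).
by have [] := yx v (conj bv (iffRL (translateE P y v) Pv)).
Qed.

Section FLC.
Variable P : set 'rV[R]_n.
Hypotheses (P_Delone : Delone P) (P_flc : finite_local_complexity P).

(** Points of [P] that approximate [z] are eventually equal, by separation. *)
Lemma Delone_closed z : (forall e : R, 0 < e -> exists2 q, P q & `|z - q| < e) -> P z.
Proof.
move=> h; have [s s0 sep] := uniformly_discrete_sep (proj1 P_Delone).
have [q Pq zq] := h _ (divr_gt0 s0 (ltr0Sn _ 1)).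
suff -> : z = q by [].
apply/eqP; rewrite -subr_eq0 -normr_le0; apply/ler_addgt0Pl => e e0.
rewrite addr0; have [|q' Pq' zq'] := h (Num.min e (s / 2)).
  by rewrite lt_min e0 divr_gt0.
move: zq'; rewrite lt_min => /andP[ze zs].
suff -> : q = q' by exact: ltW.
by apply: sep => //; rewrite (le_lt_trans (ler_distD z _ _)) // distrC; lra.
Qed.

(** Finite local complexity says that bounded difference vectors are finite in
    number, so two of them cannot be close without being equal. *)
Lemma flc_differences (K : R) : exists2 e : R, 0 < e &
  forall p p' q q', P p -> P p' -> P q -> P q' -> `|p' - p| < K ->
    `|(p' - p) - (q' - q)| < e -> p' - p = q' - q.
Proof.
have [s s0 sep] := uniformly_discrete_sep (proj1 P_Delone).
pose r := n.+1%:R * (K + 1).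
pose D := \bigcup_(A in [set ball_patch r (translate P x) | x in P]) A.
have Dfin : finite_set D.
  apply: bigcup_finite => // _ [p Pp <-].
  apply: (@separated_bounded_finite _ _ _ s r s0) => [v w|v].
    move=> [_ /translateE Pv] [_ /translateE Pw] vw.
    by apply: (addrI p); apply: sep => //; rewrite opprD addrACA subrr add0r.
  move=> []; rewrite /euclid_ball /= subr0 => /ltW h _.
  exact: le_trans (normr_le_euclid _) h.
have inD p p' : P p -> P p' -> `|p' - p| < K + 1 -> D (p' - p).
  move=> Pp Pp' pp'; exists (ball_patch r (translate P p)); first by exists p.
  split; last by apply/translateE; rewrite addrC subrK.
  rewrite /euclid_ball /= subr0 (le_lt_trans (euclid_le_normr _)) //.
  by rewrite ltr_pM2l ?ltr0n.
have [||e e0 he] := @finite_pos_lbound R _ (D `*` D)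
    (fun a => if a.1 == a.2 then 1 else `|a.1 - a.2|).
- exact: finite_setX.
- by move=> [a b] _ /=; case: eqVneq => // ab; rewrite normr_gt0 subr_eq0.
exists (Num.min e 1); first by rewrite lt_min e0 ltr01.
move=> p p' q q' Pp Pp' Pq Pq' pK; rewrite lt_min => /andP[pe p1].
have Dp : D (p' - p) by apply: inD => //; lra.
have Dq : D (q' - q).
  apply: inD => //; have -> : q' - q = (p' - p) - ((p' - p) - (q' - q)).
    by rewrite subKr.
  by rewrite (le_lt_trans (ler_normB _ _)) //; lra.
have := he (p' - p, q' - q) (conj Dp Dq); rewrite /=.
by case: eqVneq => // _; rewrite leNgt pe.
Qed.

(** There are finitely many patches of a given size, and an ultrafilter picks
    one of them. *)
Lemma flc_ultra {T : Type} (F : set_system T) (f : T -> 'rV[R]_n) (r : R) :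
  UltraFilter F -> (forall t, P (f t)) ->
  exists2 q, P q & F [set t | agree P r (f t) q].
Proof.
move=> FU Pf; pose k := n.+1%:R * r.
have [|_ [q Pq <-] Fq] := @ultra_finite_cover T _ F
  [set ball_patch k (translate P x) | x in P]
  (fun A => [set t | ball_patch k (translate P (f t)) = A]) FU (P_flc k).
  apply: filterS filterT => t _ /=.
  by exists (ball_patch k (translate P (f t))) => //; exists (f t).
exists q => //; apply: filterS Fq => t /=; exact: patch_agree.
Qed.

End FLC.
End Delone.

(** * The hull and its metric *)

Section Hull.
Context {R : realType} {n : nat}.
Variables (P : set 'rV[R]_n) (Om : metricType R) (i : set 'rV[R]_n -> Om).
Hypotheses (P_Delone : Delone P) (P_flc : finite_local_complexity P).
Hypothesis P_hull : is_hull P i.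
Implicit Types (x y z p q v h : 'rV[R]_n) (w : Om).

Local Notation hull_dist x y := (mdist (i (translate P x)) (i (translate P y))).

Lemma hull_distE x y : hull_dist x y = pattern_dist (translate P x) (translate P y).
Proof. by case: P_hull => _ -> //; [exists x|exists y]. Qed.

Lemma translate_nonempty x : translate P x !=set0.
Proof.
have [r r0 /(_ 0)[p Pp _]] := relatively_dense_near (proj2 P_Delone).
by exists (p - x); exists p.
Qed.

Lemma hull_dist_match (K e : R) : 0 < e -> exists2 d : R, 0 < d &
  forall x y, hull_dist x y < d -> forall p, P p -> `|p - x| < K ->
  exists2 q, P q & `|(p - x) - (q - y)| < e.
Proof.
move=> e0; pose k := n.+1%:R * `|K| + 1.
have k1 : 1 <= k by rewrite lerDr mulr_ge0 ?ler0n.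
have k0 : 0 < k by rewrite (lt_le_trans ltr01).
exists (Num.min e k^-1) => [|x y]; first by rewrite lt_min e0 invr_gt0.
set d := Num.min _ _; have d0 : 0 < d by rewrite lt_min e0 invr_gt0.
have dk : d <= k^-1 by rewrite ge_min lexx orbT.
have kd : k <= d^-1 by rewrite -(invrK k) lef_pV2 // posrE ?invr_gt0.
have d1 : d <= 1 by rewrite (le_trans dk) // invf_le1.
rewrite hull_distE => xy p Pp px.
have [||q] := pattern_dist_match (translate_nonempty x) (translate_nonempty y) xy (a := p - x).
- by exists p.
- rewrite (le_trans _ kd) // lerD // (le_trans (euclid_le_normr _)) //.
  by rewrite ler_wpM2l ?ler0n // (le_trans (ltW px)) // ler_norm.
move=> [q' Pq' <-] h; exists q' => //.
by rewrite (le_lt_trans (normr_le_euclid _)) // (lt_le_trans h) // ge_min lexx.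
Qed.

Lemma hull_dist_agree (e : R) : 0 < e -> exists2 r : R, 0 < r &
  forall x y, agree P r x y -> hull_dist x y < e.
Proof.
move=> e0; have r0 : 0 < (e / 2)^-1 by rewrite invr_gt0 divr_gt0.
exists (e / 2)^-1 => // x y xy; rewrite hull_distE.
apply: (@le_lt_trans _ _ (e / 2)); last lra.
rewrite -[leRHS]invrK; apply: pattern_dist_agree => // v hv.
rewrite !translateE; apply: xy.
exact: le_lt_trans (normr_le_euclid v) hv.
Qed.

Lemma hull_dist_shift (e : R) : 0 < e -> exists2 d : R, 0 < d &
  forall x y, `|x - y| < d -> hull_dist x y < e.
Proof.
move=> e0; pose e1 := Num.min (e / 2) 2^-1.
have e10 : 0 < e1 by rewrite lt_min divr_gt0 //= invr_gt0.
exists (e1 / n.+1%:R) => [|x y xy]; first by rewrite divr_gt0.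
apply: (@le_lt_trans _ _ e1); last first.
  by rewrite gt_min; apply/orP; left; lra.
rewrite hull_distE; apply: (@pattern_dist_shift _ _ _ _ (y - x)).
- by rewrite e10 gt_min; apply/orP; right; lra.
- rewrite (le_lt_trans (euclid_le_normr _)) // distrC.
  by move: xy; rewrite ltr_pdivlMr // mulrC.
- move=> v; rewrite !translateE; suff -> : y + (v - (y - x)) = x + v by [].
  by vring.
Qed.

(** Matching points carry the same patch: the points of the two patches match
    up to a small error, and by finite local complexity this error is zero. *)
Lemma hull_dist_patch (r K : R) : exists2 e : R, 0 < e &
  forall x y p q, hull_dist x y < e -> P p -> P q -> `|p - x| < K ->
    `|(p - x) - (q - y)| < e -> agree P r p q.
Proof.
have [e0 e00 He0] := flc_differences P_Delone P_flc r.
have [e1 [e10 e11 e12]] := pos_le2 (divr_gt0 e00 (ltr0Sn _ 1)) (@ltr01 R).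
have [d d0 Hd] := hull_dist_match (r + K + 1) e10.
have [e2 [e20 e21 e22]] := pos_le2 d0 e10; exists e2 => //.
suff H x y p q : hull_dist x y < d -> P p -> P q -> `|p - x| < K + 1 ->
    `|(p - x) - (q - y)| < e0 / 2 -> forall v, `|v| < r -> P (p + v) -> P (q + v).
  move=> x y p q xy Pp Pq px pq v vr.
  split; first by apply: (H x y) => //; lra.
  apply: (H y x) => //; first by rewrite metric_sym; lra.
    by have := ler_normB (p - x) ((p - x) - (q - y)); rewrite subKr; lra.
  by rewrite distrC; lra.
move=> xy Pp Pq px pq v vr Ppv.
have pvx : `|p + v - x| < r + K + 1.
  rewrite (_ : p + v - x = v + (p - x)); last by vring.
  by rewrite (le_lt_trans (ler_normD _ _)) //; lra.
have [q' Pq' h] := Hd _ _ xy _ Ppv pvx.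
suff e : v = q' - q by rewrite e addrC subrK.
have vE : p + v - p = v by rewrite addrAC subrr add0r.
have := He0 p (p + v) q q' Pp Ppv Pq Pq'; rewrite vE; apply => //.
have -> : v - (q' - q) = (p + v - x - (q' - y)) - (p - x - (q - y)) by vring.
by rewrite (le_lt_trans (ler_normB _ _)) //; lra.
Qed.

(** Small shifts are visible in the hull: this separates the translates of one
    pattern along its orbit, although the orbit returns close to itself. *)
Lemma hull_dist_gap : exists2 s : R, 0 < s &
  forall e : R, 0 < e -> exists2 d : R, 0 < d &
  forall x y, `|x - y| < s -> hull_dist x y < d -> `|x - y| < e.
Proof.
have [s s0 sep] := uniformly_discrete_sep (proj1 P_Delone).
have [r r0 near] := relatively_dense_near (proj2 P_Delone).
exists (s / 2) => [|e e0]; first by rewrite divr_gt0.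
have [e1 [e10 e11 e12]] := pos_le2 e0 (divr_gt0 s0 (ltr0Sn _ 1)).
have [d d0 Hd] := hull_dist_match r e10.
exists d => // x y xys xy; have [p Pp px] := near x.
have [q Pq h1] := Hd _ _ xy _ Pp px.
have pq : p = q.
  apply: sep => //; have -> : p - q = (p - x - (q - y)) + (x - y) by vring.
  by rewrite (le_lt_trans (ler_normD _ _)) //; lra.
move: h1; rewrite pq (_ : q - x - (q - y) = - (x - y)); last by vring.
rewrite normrN; lra.
Qed.

Lemma hull_inj_translate x y :
  i (translate P x) = i (translate P y) -> translate P x = translate P y.
Proof.
suff H x' y' : i (translate P x') = i (translate P y') ->
    translate P x' `<=` translate P y'.
  by move=> xy; apply/seteqP; split; apply: H.
move=> xy v /translateE Pv; apply/translateE.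
apply: (Delone_closed P_Delone) => e e0.
have [d d0 Hd] := hull_dist_match (`|v| + 1) e0.
have [||q Pq h] := Hd x' y' _ _ Pv; first by rewrite xy mdistxx.
  by rewrite addrC addKr ltrDl.
by exists q => //; rewrite (_ : _ - q = x' + v - x' - (q - y')) //; vring.
Qed.

Lemma hull_inj : aperiodic P -> forall x y,
  i (translate P x) = i (translate P y) -> x = y.
Proof.
move=> aper x y /hull_inj_translate xy; apply/eqP; rewrite -subr_eq0; apply/eqP.
apply: aper; apply/seteqP; split=> v.
  move=> /translateE Pv; have : translate P x (v - y).
    by apply/translateE; suff -> : x + (v - y) = x - y + v by []; vring.
  by rewrite xy translateE addrC subrK.
move=> Pv; have : translate P y (v - y) by apply/translateE; rewrite addrC subrK.
rewrite -xy !translateE; suff -> : x + (v - y) = x - y + v by []; by vring.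
Qed.

(** A limit of translates that contain the origin contains the origin. *)
Lemma transversal_mem x : transversal_of P i (i (translate P x)) -> P x.
Proof.
move=> cl; apply: (Delone_closed P_Delone) => e e0.
have [d d0 Hd] := hull_dist_match 1 e0.
have [_ [[p Pp <-]]] := cl _ (nbhsx_ballx (i (translate P x)) d d0).
rewrite ballEmdist /= metric_sym => px; have [|q Pq h] := Hd _ _ px _ Pp.
  by rewrite subrr normr0.
by exists q => //; move: h; rewrite subrr sub0r normrN distrC.
Qed.

Lemma transversal_translate p : P p -> transversal_of P i (i (translate P p)).
Proof. by move=> Pp; apply: subset_closure; exists p. Qed.

Lemma orb_dense w (e : R) : 0 < e -> exists x, mdist w (i (translate P x)) < e.
Proof.
move=> e0; case: P_hull => _ _ /(_ (ball w e)°).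
case=> [||w' [h [_ [x _ <-] xw]]].
- by exists w; exact: nbhsx_ballx.
- exact: open_interior.
- by exists x; move: (interior_subset h); rewrite -xw ballEmdist.
Qed.

(** By finite local complexity an ultrafilter on the hull settles on one patch
    of any given size, and on one position of it: it is Cauchy. *)
Lemma hull_compact : compact [set: Om].
Proof.
rewrite compact_ultra => F FU _.
suff [w Fw] : exists w, F --> w by exists w.
case: P_hull => complete _ _; apply: complete.
apply/cauchy_exP => e e0.
have [r r0 near] := relatively_dense_near (proj2 P_Delone).
have e40 : 0 < e / 4 by rewrite divr_gt0.
have /choice[x hx] : forall w, exists x, mdist w (i (translate P x)) < e / 4.
  by move=> w; exact: orb_dense.
have /choice[p hp] : forall w, exists p, P p /\ `|p - x w| < r.
  by move=> w; have [p Pp px] := near (x w); exists p.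
pose h w := x w - p w.
have [d d0 Hd] := hull_dist_shift e40.
have [r1 r10 Hr1] := hull_dist_agree e40.
have [|h0 [_ clh]] := @compact_normr_le R n r (h @ F).
  suff : F [set w | `|h w| <= r] by [].
  by apply: filterS filterT => w _ /=; have [_ /ltW] := hp w; rewrite distrC.
have Fh : F [set w | `|h w - h0| < d].
  have [//|Fn] := in_ultra_setVsetC [set w | `|h w - h0| < d] FU.
  have [v [/= v1]] := clh [set v | ~ `|v - h0| < d] _ Fn (nbhsx_ballx h0 d d0).
  by rewrite -ball_normE /= distrC.
have [q Pq Fq] := flc_ultra P_flc (r1 + (r + d)) FU (fun w => (hp w).1).
exists (i (translate P (q + h0))).
apply: filterS (filterI Fh Fq) => w [/= hw aw].
rewrite ballEmdist /= metric_sym.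
have h0r : `|h0| <= r + d.
  have := ler_normB (h w) (h w - h0); rewrite subKr.
  by have := (hp w).2; rewrite distrC -/(h w); lra.
have s1 : hull_dist (x w) (p w + h0) < e / 4.
  apply: Hd; suff -> : x w - (p w + h0) = h w - h0 by [].
  by rewrite /h; vring.
have s2 : hull_dist (p w + h0) (q + h0) < e / 4.
  by apply: Hr1; apply: agree_shift h0r.
have := metric_triangle w (i (translate P (x w))) (i (translate P (q + h0))).
have := metric_triangle (i (translate P (x w))) (i (translate P (p w + h0)))
   (i (translate P (q + h0))).
have := hx w; lra.
Qed.

End Hull.

(** The theorem of Heine and Cantor. *)
Lemma compact_unif_continuous {R : realType} (T U : metricType R) (f : T -> U) :
  compact [set: T] -> continuous f -> forall e : R, 0 < e ->
  exists2 d : R, 0 < d & forall x y, mdist x y < d -> mdist (f x) (f y) < e.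
Proof.
move=> /compact_near_coveringP cT cf e e0.
have [] := cT R 0^'+ (fun d x => forall y, mdist x y < d -> mdist (f x) (f y) < e) _ _.
  move=> x _; have e20 : 0 < e / 2 by rewrite divr_gt0.
  have := cf x; move/metricType_numDomainType.cvgrPdist_lt => /(_ _ e20).
  move=> /metricType_numDomainType.nbhs_mdistP[d /= d0 Hd].
  have d20 : 0 < d / 2 by rewrite divr_gt0.
  near=> x' t => y x'y.
  have xx' : mdist x x' < d / 2.
    near: x'; apply/metricType_numDomainType.nbhs_mdistP.
    by exists (d / 2).
  have td : t < d / 2 by near: t; exact: nbhs_right_lt.
  have xd : mdist x x' < d by rewrite (lt_trans xx') // ltr_pdivrMr // ltr_pMr // ltr1n.
  have yd : mdist x y < d.
    by rewrite (le_lt_trans (metric_triangle x x' y)) // [d]splitr ltrD // (lt_trans x'y).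
  rewrite (le_lt_trans (metric_triangle (f x') (f x) (f y))) // [e]splitr ltrD //.
    by rewrite metric_sym; exact: (Hd x').
  exact: (Hd y).
move=> d /= d0 Hd; exists (d / 2) => [|x y]; first by rewrite divr_gt0.
have d20 : 0 < d / 2 by rewrite divr_gt0.
apply: (Hd (d / 2)) => //=; rewrite sub0r normrN gtr0_norm //; lra.
Unshelve. all: by end_near. Qed.

(** * Paths in the hull *)

Section Chains.
Context {R : realType}.

(** The reals being archimedean, finitely many steps lead from [0] to [1]. *)
Lemma unit_chain_ind (A : R -> Prop) (d : R) : 0 < d -> A 0 ->
  (forall s t, 0 <= s <= 1 -> 0 <= t <= 1 -> `|t - s| < d -> A s -> A t) -> A 1.
Proof.
move=> d0 A0 step; pose N := (Num.truncn d^-1).+1.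
have N0 : (0 : R) < N%:R by rewrite ltr0n.
have Nd : N%:R^-1 < d.
  by rewrite -[ltRHS]invrK ltf_pV2 ?posrE ?invr_gt0 // truncnS_gt.
have AN k : (k <= N)%N -> A (k%:R / N%:R).
  elim: k => [|k IH kN]; first by rewrite mul0r.
  have kN01 j : (j <= N)%N -> 0 <= (j%:R / N%:R : R) <= 1.
    by move=> jN; rewrite divr_ge0 //= ler_pdivrMr // mul1r ler_nat.
  apply: (step (k%:R / N%:R)); rewrite ?kN01 ?(ltnW kN) //; last exact/IH/ltnW.
  by rewrite -mulrBl -natrB // subSnn mul1r ger0_norm // invr_ge0 ltW.
by have := AN N (leqnn N); rewrite divff // gt_eqF.
Qed.

Context {n : nat}.
Implicit Types (x y z : 'rV[R]_n).

Lemma unif_chain_ind (A : 'rV[R]_n -> Prop) (d : R) x : 0 < d -> A x ->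
  (forall y z, `|z - y| < d -> A y -> A z) -> forall y, A y.
Proof.
move=> d0 Ax step y; pose k := `|y - x| + 1.
have k0 : 0 < k by rewrite ltr_wpDl.
suff : A (x + 1 *: (y - x)) by rewrite scale1r addrC subrK.
apply: (@unit_chain_ind (fun t => A (x + t *: (y - x))) (d / k)).
- by rewrite divr_gt0.
- by rewrite scale0r addr0.
move=> s t _ _ st; apply: step; rewrite opprD addrACA subrr add0r -scalerBl.
rewrite normrZ; move: st; rewrite ltr_pdivlMr //; apply: le_lt_trans.
by rewrite ler_wpM2l // lerDl.
Qed.

(** A segment of length [K] is covered by a bounded number of steps of length
    [d], each of which contributes at most [1]. *)
Lemma unif_continuous_coarse (f : 'rV[R]_n -> 'rV[R]_n) (d : R) : 0 < d ->
  (forall x y, `|x - y| < d -> `|f x - f y| < 1) ->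
  forall K : R, exists M : R, forall x y, `|x - y| < K -> `|f x - f y| <= M.
Proof.
move=> d0 fd K; pose N := (Num.truncn (`|K| / d)).+1.
have N0 : (0 : R) < N%:R by rewrite ltr0n.
exists N%:R => x y xy; pose z (k : nat) := x + (k%:R / N%:R) *: (y - x).
suff H k : `|f x - f (z k)| <= k%:R.
  have zN : z N = y by rewrite /z divff ?gt_eqF // scale1r addrC subrK.
  by rewrite -[in leLHS]zN.
elim: k => [|k IH]; first by rewrite /z mul0r scale0r addr0 subrr normr0.
rewrite (le_trans (ler_distD (f (z k)) _ _)) // -natr1 lerD // ltW // fd //.
rewrite /z opprD addrACA subrr add0r -scalerBl normrZ -mulrBl.
rewrite -opprB -natrB ?leqnSn // subSnn mulNr normrN mul1r gtr0_norm ?invr_gt0 //.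
rewrite mulrC ltr_pdivrMr // distrC (lt_le_trans xy) // (le_trans (ler_norm K)) //.
by rewrite mulrC -ler_pdivrMr // ltW // truncnS_gt.
Qed.

End Chains.

Section Lifting.
Context {R : realType} {n : nat}.
Variables (P : set 'rV[R]_n) (Om : metricType R) (i : set 'rV[R]_n -> Om).
Hypotheses (P_Delone : Delone P) (P_flc : finite_local_complexity P).
Hypothesis P_hull : is_hull P i.
Implicit Types (x y z p q v h c : 'rV[R]_n).

Local Notation hull_dist x y := (mdist (i (translate P x)) (i (translate P y))).

(** A bounded piece of an orbit is the continuous image of a compact ball, hence
    closed in the hull. *)
Lemma orbit_arc_closed c (r : R) w :
  (forall e : R, 0 < e -> exists2 c', `|c' - c| <= r &
     mdist w (i (translate P c')) < e) ->
  exists2 c', `|c' - c| <= r & w = i (translate P c').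
Proof.
move=> H; pose f h := i (translate P (c + h)).
have cf : continuous f.
  move=> h; apply/(metricType_numDomainType.cvgrPdist_lt (FF := nbhs_filter h)) => e e0.
  have [d d0 Hd] := hull_dist_shift P_hull e0.
  apply/nbhs_ballP; exists d => //= h'; rewrite -ball_normE /= => hh'.
  by apply: Hd; rewrite opprD addrACA subrr add0r.
have Kcl : closed (f @` [set h | `|h| <= r]).
  apply: compact_closed; first exact: metric_hausdorff.
  apply: continuous_compact; last exact: compact_normr_le.
  exact: continuous_subspaceT.
have [h hr <-] : (f @` [set h | `|h| <= r]) w.
  apply: Kcl => B /metricType_numDomainType.nbhs_mdistP[e /= e0 eB].
  have [c' c'r wc'] := H e e0; exists (i (translate P c')); split; last exact: eB.
  by exists (c' - c) => //; rewrite /f addrC subrK.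
by exists (c + h) => //; rewrite addrAC subrr add0r.
Qed.

(** The hull is locally a product of a ball, where translations act, and a
    totally disconnected set of patterns.  A short path that starts in the
    orbit therefore stays in it, and moves along it by a small translation:
    as the path proceeds, a point of the pattern can be followed, and the patch
    of any prescribed radius around this point, taking only finitely many
    values, is constant. *)
Lemma orbit_lift (F : 'rV[R]_n -> Om) :
  (forall e : R, 0 < e -> exists2 d : R, 0 < d &
     forall x y, `|x - y| < d -> mdist (F x) (F y) < e) ->
  forall eta : R, 0 < eta -> exists2 d : R, 0 < d &
    forall x c y, F x = i (translate P c) -> `|x - y| < d ->
    exists2 c', `|c' - c| < eta & F y = i (translate P c').
Proof.
move=> Fuc eta eta0.
have [s s0 sep] := uniformly_discrete_sep (proj1 P_Delone).
have [r r0 near] := relatively_dense_near (proj2 P_Delone).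
have [e0 [e00 e0eta e0s]] := pos_le2 (divr_gt0 eta0 (ltr0Sn R 2)) (divr_gt0 s0 (ltr0Sn R 7)).
have [d0 d00 match0] := hull_dist_match P_Delone P_hull (r + s) e00.
have [d dgt0 Fd] := Fuc _ (divr_gt0 d00 (ltr0Sn R 1)).
exists d => // x c y Fx xy; have [p Pp pc] := near c.
(* it is enough to approximate [F y] by patterns on a short arc of the orbit *)
have [c' c'c ->] : exists2 c', `|c' - c| <= 2 * e0 & F y = i (translate P c').
  apply: orbit_arc_closed => e egt0.
  have [r1 r10 agr] := hull_dist_agree P_hull (divr_gt0 egt0 (ltr0Sn R 1)).
  have [e5 e50 patch5] := hull_dist_patch P_Delone P_flc P_hull (r1 + (r + s)) (r + s).
  have [e6 [e60 e65 e6e0]] := pos_le2 e50 e00.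
  have [d6 d60 match6] := hull_dist_match P_Delone P_hull (r + s) e60.
  have [e7 [e70 e7d6 e7e5]] := pos_le2 d60 e50.
  have [e8 [e80 e8e7 e8d0]] := pos_le2 e70 d00.
  have [e9 [e90 e9e8 e9e]] := pos_le2 e80 egt0.
  have e930 := divr_gt0 e90 (ltr0Sn R 2).
  (* one step of the walk: a point of a pattern is followed into a close one *)
  have follow x1 x2 q : hull_dist x1 x2 < e9 -> P q -> `|q - x1| < r + s ->
      exists q', [/\ P q', `|(q - x1) - (q' - x2)| < e6 & agree P (r1 + (r + s)) q q'].
    move=> x12 Pq qx1; have [||q' Pq' qq'] := match6 x1 x2 _ _ Pq => //; first lra.
    by exists q'; split=> //; apply: (patch5 x1 x2) => //; lra.
  pose z t := x + t *: (y - x).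
  pose A t := forall x', mdist (F (z t)) (i (translate P x')) < e9 / 3 ->
    exists q, [/\ P q, `|(q - x') - (p - c)| < 2 * e0 & agree P (r1 + (r + s)) q p].
  have near_p q x' : `|(q - x') - (p - c)| < 2 * e0 -> `|q - x'| < r + 2 * e0.
    move=> h; have -> : q - x' = (q - x' - (p - c)) + (p - c) by rewrite subrK.
    by have := ler_normD (q - x' - (p - c)) (p - c); lra.
  have : A 1.
    have [d9 d90 Fd9] := Fuc _ e930.
    apply: (@unit_chain_ind _ _ (d9 / d)); first by rewrite divr_gt0.
      move=> x'; rewrite /z scale0r addr0 Fx => cx'.
      have [||q [Pq pq aq]] := follow c x' p _ Pp; [lra|lra|].
      exists q; split=> //; last exact: agree_sym.
      rewrite distrC. lra.
    move=> a b a01 b01 ab Aa x' Fx'.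
    have zab : mdist (F (z a)) (F (z b)) < e9 / 3.
      apply: Fd9; rewrite /z opprD addrACA subrr add0r -scalerBl normrZ distrC.
      move: ab; rewrite ltr_pdivlMr //; apply: le_lt_trans.
      by rewrite ler_wpM2l // distrC ltW.
    have zbx : mdist (F (z b)) (F x) < d0 / 2.
      apply: Fd; rewrite /z addrAC subrr add0r normrZ.
      apply: le_lt_trans xy; rewrite distrC ger0_norm; last by case/andP: b01.
      by rewrite ler_piMl //; case/andP: b01.
    have [x2 Fx2] := orb_dense P_hull (F (z a)) e930.
    have [q [Pq qp aq]] := Aa _ Fx2.
    have x2x' : hull_dist x2 x' < e9.
      have := metric_triangle (i (translate P x2)) (F (z a)) (i (translate P x')).
      have := metric_triangle (F (z a)) (F (z b)) (i (translate P x')).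
      by rewrite (metric_sym (i _) (F (z a))); lra.
    have x'c : hull_dist x' c < d0.
      have := metric_triangle (i (translate P x')) (F (z b)) (F x).
      by rewrite -Fx (metric_sym (i _) (F (z b))); lra.
    have qx2 := near_p _ _ qp.
    have [|q' [Pq' qq' aq']] := follow x2 x' q x2x' Pq; first lra.
    have q'x' : `|q' - x'| < r + s.
      by have := ler_normB (q - x2) (q - x2 - (q' - x')); rewrite subKr; lra.
    have [p' Pp' q'p'] := match0 _ _ x'c _ Pq' q'x'.
    (* the comparison is with the start of the path, so that the errors do not
       add up along it: their sum is below [4 * e0 <= s / 2] *)
    have p'p : p' = p.
      apply: sep => //.
      have -> : p' - p = (q - x2 - (p - c)) - ((q' - x' - (p' - c)) + (q - x2 - (q' - x'))).
        by vring.
      rewrite (le_lt_trans (ler_normB _ _)) //.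
      by have := ler_normD (q' - x' - (p' - c)) (q - x2 - (q' - x')); lra.
    exists q'; split=> //; first by rewrite -{1}p'p; lra.
    exact: agree_trans (agree_sym aq') aq.
  rewrite /A /z scale1r addrC subrK => A1.
  (* up to [2 * e0], [q] sits in [P - x'] where [p] sits in [P - c] *)
  have [x' Fx'] := orb_dense P_hull (F y) e930.
  have [q [Pq qp aq]] := A1 _ Fx'; have qx' := near_p _ _ qp.
  exists (p + (x' - q)).
    have -> : p + (x' - q) - c = - (q - x' - (p - c)) by vring.
    by rewrite normrN ltW.
  have : hull_dist x' (p + (x' - q)) < e / 2.
    apply: agr; rewrite -{1}[x'](subrK q) addrC.
    by apply: agree_shift aq _; rewrite distrC; lra.
  have := metric_triangle (F y) (i (translate P x')) (i (translate P (p + (x' - q)))).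
  lra.
exists c' => //; lra.
Qed.

End Lifting.

(** * The cocycle of a map between hulls *)

Section HullMap.
Context {R : realType} {n : nat}.
Variables (P Q : set 'rV[R]_n) (Om Om' : metricType R).
Variables (i : set 'rV[R]_n -> Om) (i' : set 'rV[R]_n -> Om').
Hypotheses (P_Delone : Delone P) (P_flc : finite_local_complexity P).
Hypotheses (Q_Delone : Delone Q) (Q_flc : finite_local_complexity Q).
Hypotheses (P_hull : is_hull P i) (Q_hull : is_hull Q i').
Variable Psi : Om -> Om'.
Hypothesis Psi_cont : continuous Psi.
Implicit Types (x y z p q v h c : 'rV[R]_n).

Let Psi_unif := compact_unif_continuous (hull_compact P_Delone P_flc P_hull) Psi_cont.

Lemma hull_map_unif (e : R) : 0 < e -> exists2 d : R, 0 < d &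
  forall x y, `|x - y| < d ->
    mdist (Psi (i (translate P x))) (Psi (i (translate P y))) < e.
Proof.
move=> e0; have [d d0 Hd] := Psi_unif e0.
have [d' d'0 Hd'] := hull_dist_shift P_hull d0.
by exists d' => // x y xy; apply/Hd/Hd'.
Qed.

(** Reach [x] from the origin by small steps, each of which is lifted. *)
Lemma hull_map_orbit c : Psi (i P) = i' (translate Q c) ->
  forall x, exists c', Psi (i (translate P x)) = i' (translate Q c').
Proof.
move=> Pc; have [d d0 Hd] := orbit_lift Q_Delone Q_flc Q_hull hull_map_unif (@ltr01 R).
apply: (@unif_chain_ind _ _ _ d 0) => //; first by exists c; rewrite translate0.
move=> y z yz [c1 yc1]; have [|c2 _ zc2] := Hd _ _ z yc1; last by exists c2.
by rewrite distrC.
Qed.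

Hypothesis Q_aper : aperiodic Q.
Variable f : 'rV[R]_n -> 'rV[R]_n.
Hypothesis fE : forall x, Psi (i (translate P x)) = i' (translate Q (f x)).

(** By aperiodicity the lift of a short path has to be the cocycle itself. *)
Lemma hull_cocycle_unif (e : R) : 0 < e -> exists2 d : R, 0 < d &
  forall x y, `|x - y| < d -> `|f x - f y| < e.
Proof.
move=> e0; have [d d0 Hd] := orbit_lift Q_Delone Q_flc Q_hull hull_map_unif e0.
exists d => // x y xy; have [c cx] := Hd _ _ _ (fE x) xy.
by rewrite fE => /(hull_inj Q_Delone Q_hull Q_aper) ->; rewrite distrC.
Qed.

Lemma hull_cocycle_coarse (K : R) : exists M : R, forall x y,
  `|x - y| < K -> `|f x - f y| <= M.
Proof.
have [d d0 Hd] := hull_cocycle_unif (@ltr01 R).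
exact: unif_continuous_coarse d0 Hd K.
Qed.

Hypothesis f_points : forall p, P p -> Q (f p).

(** Move from two points [p], [p1] of [P] with the same large patch along the
    same vector [v].  The images start from points of [Q] with the same patch
    and stay close to each other in the hull, so the two displacements cannot
    separate: to do so they would have to jump over the gap that isolates the
    small translations of a pattern.  At the end of the way both displacements
    lead to points of the same patch of [Q], and are therefore equal. *)
Lemma hull_cocycle_local (rho : R) : exists r : R, forall p p1 v,
  P p -> P p1 -> agree P r p p1 -> `|v| < rho -> P (p + v) -> P (p1 + v) ->
  f (p + v) - f p = f (p1 + v) - f p1.
Proof.
have [M fM] := hull_cocycle_coarse rho.
have [s s0 sep] := uniformly_discrete_sep (proj1 Q_Delone).
have [s1 s10 gap] := hull_dist_gap Q_Delone Q_hull.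
have [e1 [e10 e1s1 e1s]] := pos_le2 (divr_gt0 s10 (ltr0Sn R 3)) s0.
have [d1 d10 Hd1] := gap _ e10.
have [d2 d20 Hd2] := hull_cocycle_unif (divr_gt0 s10 (ltr0Sn R 3)).
have [r1 r10 Hr1] := hull_dist_agree Q_hull (divr_gt0 d10 (ltr0Sn R 1)).
have [e3 e30 He3] := hull_dist_patch Q_Delone Q_flc Q_hull (r1 + `|M|) 1.
have [e4 [e40 e43 e4d1]] := pos_le2 e30 (divr_gt0 d10 (ltr0Sn R 1)).
have [d4 d40 Hd4] := Psi_unif e40.
have [r2 r20 Hr2] := hull_dist_agree P_hull d40.
exists (r2 + `|rho|) => p p1 v Pp Pp1 pp1 vrho Ppv Pp1v.
have rho0 : 0 < rho := le_lt_trans (normr_ge0 v) vrho.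
have close (t : R) : 0 <= t <= 1 ->
    mdist (i' (translate Q (f (p + t *: v)))) (i' (translate Q (f (p1 + t *: v)))) < e4.
  move=> /andP[t0 t1]; rewrite -!fE; apply/Hd4/Hr2/(agree_shift pp1).
  rewrite normrZ ger0_norm // (ger0_norm (ltW rho0)).
  by rewrite (le_trans _ (ltW vrho)) // ler_piMl.
have agQ : agree Q (r1 + `|M|) (f p) (f p1).
  apply: (He3 (f p) (f p1)); rewrite ?subrr ?normr0 //; try exact: f_points.
  have := close 0; rewrite !scale0r !addr0 lexx ler01 => /(_ isT) h.
  exact: lt_le_trans h e43.
pose a p' t := f (p' + t *: v) - f p'.
have aM (t : R) : 0 <= t <= 1 -> `|a p t| <= `|M|.
  move=> /andP[t0 t1]; rewrite (le_trans _ (ler_norm M)) // fM //.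
  rewrite addrAC subrr add0r normrZ ger0_norm // (le_lt_trans _ vrho) //.
  by rewrite ler_piMl.
have key : `|a p 1 - a p1 1| < e1.
  apply: (@unit_chain_ind _ (fun t => `|a p t - a p1 t| < e1) (d2 / rho)).
  - by rewrite divr_gt0.
  - by rewrite /a !scale0r !addr0 !subrr normr0.
  move=> t u t01 u01 tu IH.
  have tuv : `|u *: v - t *: v| < d2.
    rewrite -scalerBl normrZ; move: tu; rewrite ltr_pdivlMr //.
    by apply: le_lt_trans; rewrite ler_wpM2l // ltW.
  have step p' : `|a p' u - a p' t| < s1 / 4.
    rewrite /a opprD addrACA opprK addNr addr0; apply: Hd2.
    by rewrite opprD addrACA subrr add0r.
  have au1 : f p1 + a p1 u = f (p1 + u *: v) by rewrite /a addrC subrK.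
  have au : f p + a p u = f (p + u *: v) by rewrite /a addrC subrK.
  have -> : a p u - a p1 u = (f p1 + a p u) - (f p1 + a p1 u) by vring.
  apply: Hd1.
    have -> : (f p1 + a p u) - (f p1 + a p1 u)
      = (a p u - a p t) - ((a p1 u - a p1 t) - (a p t - a p1 t)) by vring.
    rewrite (le_lt_trans (ler_normB _ _)) //.
    have := ler_normB (a p1 u - a p1 t) (a p t - a p1 t).
    by have := step p; have := step p1; lra.
  rewrite au1; have := Hr1 _ _ (agree_shift agQ (aM u u01)); rewrite au.
  have := close u u01.
  have := metric_triangle (i' (translate Q (f p1 + a p u)))
    (i' (translate Q (f (p + u *: v)))) (i' (translate Q (f (p1 + u *: v)))).
  by rewrite (metric_sym _ (i' (translate Q (f (p + u *: v))))); lra.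
have aE p' : a p' 1 = f (p' + v) - f p' by rewrite /a scale1r.
rewrite -!aE; apply: (addrI (f p1)); apply: sep.
- apply/agQ; first by rewrite (le_lt_trans (aM 1 _)) ?ltrDr // ler01 lexx.
  by rewrite aE addrC subrK; exact: f_points.
- by rewrite aE addrC subrK; exact: f_points.
- by rewrite opprD addrACA subrr add0r; lra.
Qed.

End HullMap.

Section Homeomorphism.
Context {R : realType} {n : nat}.
Variables (P Q : set 'rV[R]_n) (Om Om' : metricType R).
Variables (i : set 'rV[R]_n -> Om) (i' : set 'rV[R]_n -> Om').
Hypotheses (P_Delone : Delone P) (P_flc : finite_local_complexity P).
Hypotheses (Q_Delone : Delone Q) (Q_flc : finite_local_complexity Q).
Hypotheses (P_hull : is_hull P i) (Q_hull : is_hull Q i').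
Hypotheses (P_aper : aperiodic P) (Q_aper : aperiodic Q).
Variable Phi : Om -> Om'.
Hypotheses (Phi_homeo : homeomorphism Phi) (Phi_P : Phi (i P) = i' Q).
Variable f : 'rV[R]_n -> 'rV[R]_n.
Hypothesis fE : forall x, Phi (i (translate P x)) = i' (translate Q (f x)).
Implicit Types (x y z p q v h c : 'rV[R]_n).

(** The inverse homeomorphism maps orbit to orbit as well, and its cocycle is the
    inverse function. *)
Lemma hull_cocycle_inverse : exists g : 'rV[R]_n -> 'rV[R]_n,
  [/\ cancel f g, cancel g f &
      forall K : R, exists M : R, forall x y, `|x - y| < K -> `|g x - g y| <= M].
Proof.
have [Phi_cont [Psi [PhiK PsiK Psi_cont]]] := Phi_homeo.
have PsiQ : Psi (i' Q) = i (translate P 0) by rewrite -Phi_P PhiK translate0.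
have /choice[g gE] := hull_map_orbit Q_Delone Q_flc P_Delone P_flc Q_hull P_hull
  Psi_cont PsiQ.
exists g; split=> [x|y|].
- by apply: (hull_inj P_Delone P_hull P_aper); rewrite -gE -fE PhiK.
- by apply: (hull_inj Q_Delone Q_hull Q_aper); rewrite -fE -gE PsiK.
- exact: (hull_cocycle_coarse Q_Delone Q_flc P_Delone P_flc Q_hull P_hull Psi_cont P_aper gE).
Qed.

Hypothesis Phi_transversal : Phi @` transversal_of P i = transversal_of Q i'.

Lemma hull_cocycle_points p : P p -> Q (f p).
Proof.
move=> Pp; apply: (transversal_mem Q_Delone Q_hull).
rewrite -Phi_transversal -fE; exists (i (translate P p)) => //.
exact: transversal_translate.
Qed.

(** The inverse of [Phi] maps the transversal into the transversal, so the
    preimage of a point of [Q] under the cocycle is a point of [P]. *)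
Lemma hull_cocycle_image : f @` P = Q.
Proof.
have [g [fK gK _]] := hull_cocycle_inverse.
apply/seteqP; split=> [_ [p Pp <-]|q Qq]; first exact: hull_cocycle_points.
exists (g q); last exact: gK.
apply: (transversal_mem P_Delone P_hull).
have [_ [Psi [PhiK _ _]]] := Phi_homeo.
have : transversal_of Q i' (i' (translate Q q)) by exact: transversal_translate.
rewrite -Phi_transversal => -[w tw]; rewrite -[in RHS](gK q) -fE => /(can_inj PhiK) <-.
exact: tw.
Qed.

End Homeomorphism.

(** * Calculus of functions of class C^k *)

(** The differential depends on the germ of the function only. *)
Lemma near_eq_diff {K : numFieldType} {V W : normedModType K} (f g : V -> W) (x : V) :
  (\forall y \near x, f y = g y) -> differentiable g x ->
  differentiable f x /\ ('d f x = 'd g x :> (V -> W)).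
Proof.
move=> fg dg.
have exp : f \o shift x = cst (f x) + 'd g x +o_ 0 id.
  have := diff_locally dg; move/eqaddoP => H; apply/eqaddoP => e e0.
  have fgx : f x = g x := nbhs_singleton fg.
  have fg0 : \forall h \near (0 : V), f (h + x) = g (h + x).
    by move: fg; rewrite (near_shift (0 : V)) subr0.
  apply: filterS2 (H e e0) fg0 => h.
  by rewrite /= !fctE /= fgx => hh ->.
have dE : 'd f x = 'd g x :> (V -> W).
  by apply: diff_unique => //; exact: diff_continuous.
split=> //; apply/diff_locallyP; rewrite dE; split=> //; exact: diff_continuous.
Qed.

Lemma near_eq_near_diff {K : numFieldType} {V W : normedModType K}
    (f g : V -> W) (x v : V) : (forall y, differentiable g y) ->
  (\forall y \near x, f y = g y) -> \forall y \near x, 'd f y v = 'd g y v.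
Proof.
move=> dg /near_join; apply: filterS => y fgy.
by have [_ ->] := near_eq_diff fgy (dg y).
Qed.

Lemma near_eq_continuous {T U : topologicalType} (f g : T -> U) (x : T) :
  (\forall y \near x, f y = g y) -> g @ x --> g x -> f @ x --> f x.
Proof.
move=> fg; rewrite (nbhs_singleton fg); apply: cvg_trans.
by apply: near_eq_cvg; apply: filterS fg => y ->.
Qed.

Lemma is_diff_shift {K : numFieldType} {V : normedModType K} (x0 x : V) :
  is_diff x (shift x0) id.
Proof.
have -> : shift x0 = id + cst x0 by [].
by apply: is_diff_eq; rewrite addr0.
Qed.

Lemma diff_shift {K : numFieldType} {V W : normedModType K} (f : V -> W) (x0 x : V) :
  differentiable f (x + x0) ->
  differentiable (fun y => f (y + x0)) x /\
  ('d (fun y => f (y + x0)) x = 'd f (x + x0) :> (V -> W)).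
Proof.
move=> df; have [ds dsE] := is_diff_shift x0 x.
split; first exact: (@differentiable_comp _ _ _ _ (shift x0) f).
transitivity ('d f (x + x0) \o 'd (shift x0) x); last by rewrite dsE.
exact: (@diff_comp _ _ _ _ (shift x0) f x ds df).
Qed.

Lemma diff_near_shift {K : numFieldType} {V W : normedModType K} (f : V -> W)
    (a x : V) (c : W) : differentiable f (x + a) ->
  (\forall z \near x, f (z + a) = f z + c) -> 'd f x = 'd f (x + a) :> (V -> W).
Proof.
move=> df fa; have [ds dsE] := diff_shift df.
have fE : \forall z \near x, f z = ((fun z => f (z + a)) - cst c) z.
  by apply: filterS fa => z; rewrite !fctE => ->; rewrite addrK.
have [|_ ->] := near_eq_diff fE; first exact: differentiableB.
rewrite diffB // diff_cst dsE; apply/funext => v /=.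
by rewrite subr0.
Qed.

Section SmoothCalculus.
Context {R : realType} {n : nat}.
Local Notation V := 'rV[R]_n.
Implicit Types (x v : V) (k : nat).

Lemma class_C_continuous {W : normedModType R} k (f : V -> W) :
  class_C k f -> continuous f.
Proof.
by case: k => // k [df _] x; exact: differentiable_continuous.
Qed.

Lemma class_CS {W : normedModType R} k (f : V -> W) : class_C k.+1 f <->
  (forall x, differentiable f x) /\ (forall v, class_C k (fun x => 'd f x v)).
Proof. by []. Qed.

Lemma class_CW {W : normedModType R} k (f : V -> W) : class_C k.+1 f -> class_C k f.
Proof.
elim: k f => [f|k IH f /class_CS[df d2f]]; first exact: class_C_continuous.
by split=> // v; apply: IH; exact: d2f.
Qed.

(** Being of class C^k is a local property.  Sums over an infinite pattern are
    treated with this, as each has finitely many terms near a given point. *)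
Lemma class_C_local {W : normedModType R} k (f : V -> W) :
  (forall x, exists2 g, class_C k g & \forall y \near x, f y = g y) -> class_C k f.
Proof.
elim: k f => [f H x|k IH f H].
  have [g cg fg] := H x.
  exact: near_eq_continuous fg (cg x).
split=> [x|v]; first by have [g /class_CS[dg _] fg] := H x; case: (near_eq_diff fg (dg x)).
apply: IH => x; have [g /class_CS[dg d2g] fg] := H x; exists (fun y => 'd g y v); first exact: d2g.
exact: near_eq_near_diff.
Qed.

Lemma class_C_cst {W : normedModType R} k (a : W) : class_C k (fun _ : V => a).
Proof.
elim: k a => [a|k IH a]; first exact: cst_continuous.
split=> [x|v]; first exact: differentiable_cst.
have -> : (fun x => 'd (fun _ : V => a) x v) = (fun _ => 0).
  by apply/funext => x; rewrite (diff_cst a x).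
exact: IH.
Qed.

Lemma class_CD {W : normedModType R} k (f g : V -> W) :
  class_C k f -> class_C k g -> class_C k (fun x => f x + g x).
Proof.
elim: k f g => [f g cf cg x|k IH f g /class_CS[df d2f] /class_CS[dg d2g]].
  exact: (continuousD (cf x) (cg x)).
split=> [x|v]; first exact: (differentiableD (df x) (dg x)).
have -> : (fun x => 'd (fun y => f y + g y) x v) = (fun x => 'd f x v + 'd g x v).
  by apply/funext => x; rewrite (diffD (df x) (dg x)).
exact: IH.
Qed.

Lemma class_C_sum {W : normedModType R} k (I : Type) (s : seq I) (F : I -> V -> W) :
  (forall j, class_C k (F j)) -> class_C k (fun x => \sum_(j <- s) F j x).
Proof.
move=> cF; elim: s => [|j s IH].
  by under [X in class_C _ X]funext do rewrite big_nil; exact: class_C_cst.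
by under [X in class_C _ X]funext do rewrite big_cons; exact: class_CD.
Qed.

Lemma class_CM k (f g : V -> R) :
  class_C k f -> class_C k g -> class_C k (fun x => f x * g x).
Proof.
elim: k f g => [f g cf cg x|k IH f g /class_CS[df d2f] /class_CS[dg d2g]].
  exact: (continuousM (cf x) (cg x)).
split=> [x|v]; first exact: (differentiableM (df x) (dg x)).
have -> : (fun x => 'd (fun y => f y * g y) x v)
          = (fun x => f x * 'd g x v + g x * 'd f x v).
  by apply/funext => x; rewrite (diffM (df x) (dg x)).
by apply: class_CD; apply: IH => //; exact: class_CW.
Qed.

Lemma class_CZl {W : normedModType R} k (f : V -> R) (a : W) :
  class_C k f -> class_C k (fun x => f x *: a).
Proof.
elim: k f => [f cf x|k IH f /class_CS[df d2f]].
  exact: (cvgZr_tmp (cf x)).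
split=> [x|v]; first exact: (differentiableZl a (df x)).
have -> : (fun x => 'd (fun y => f y *: a) x v) = (fun x => 'd f x v *: a).
  by apply/funext => x; rewrite (diffZl a (df x)).
exact: IH.
Qed.

Lemma class_CN k (f : V -> R) : class_C k f -> class_C k (fun x => - f x).
Proof.
move=> cf; have := class_CM (class_C_cst k (-1 : R)) cf.
by congr class_C; apply/funext => x; rewrite mulN1r.
Qed.

Lemma class_CV k (f : V -> R) : (forall x, f x != 0) ->
  class_C k f -> class_C k (fun x => (f x)^-1).
Proof.
move=> f0; elim: k f f0 => [f f0 cf x|k IH f f0 cf].
  exact: (cvgV (f0 x) (cf x)).
have /class_CS[df d2f] := cf.
split=> [x|v]; first exact: (differentiableV (df x) (f0 x)).
have -> : (fun x => 'd (fun y => (f y)^-1) x v)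
          = (fun x => - ((f x)^-1 * (f x)^-1 * 'd f x v)).
  apply/funext => x; rewrite (diffV (df x) (f0 x)) /=.
  by rewrite -exprVn expr2 -[LHS]/(_ * _) mulNr.
have cV := IH f f0 (class_CW cf).
by apply/class_CN/class_CM; [exact: class_CM|exact: d2f].
Qed.

Lemma class_C_coord k (j : 'I_n) : class_C k (fun x : V => x 0 j : R).
Proof.
case: k => [|k]; first by move=> x; exact: coord_continuous.
split=> [x|v]; first exact: differentiable_coord.
have -> : (fun x : V => 'd (fun y : V => y 0 j : R) x v) = (fun _ => v 0 j).
  apply/funext => x.
  have @c : {linear V -> R}.
    by exists (fun N : V => N 0 j); do 2![eexists]; do ?[constructor];
      rewrite ?mxE // => ? *; rewrite ?mxE //; move=> ?; rewrite !mxE.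
  by rewrite (_ : (fun _ => _) = c) // diff_lin //; exact: coord_continuous.
exact: class_C_cst.
Qed.

Lemma class_C_shift {W : normedModType R} k (f : V -> W) x0 :
  class_C k f -> class_C k (fun x => f (x + x0)).
Proof.
elim: k f => [f cf x|k IH f /class_CS[df d2f]].
  apply: (@continuous_comp _ _ _ (shift x0) f x); last exact: cf.
  apply: differentiable_continuous.
  by have [] := is_diff_shift x0 (x : V).
split=> [x|v]; first by have [] := diff_shift (df (x + x0)).
have -> : (fun x => 'd (fun y => f (y + x0)) x v) = (fun x => 'd f (x + x0) v).
  by apply/funext => x; exact: (congr1 (fun g => g v) (diff_shift (df (x + x0))).2).
exact: (IH (fun x => 'd f x v)).
Qed.

End SmoothCalculus.

(** * A flat function *)

Section Bump.
Context {R : realType}.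
Implicit Types (m : nat) (x y : R).

(** The functions [x^-m exp(-1/x)], extended by [0] to [x <= 0].  The family is
    closed under derivation up to linear combinations, which is how [flat 0] is
    seen to be smooth. *)
Definition flat (m : nat) (x : R) : R :=
  if 0 < x then x^-1 ^+ m * expR (- x^-1) else 0.

Lemma flat_gt0 m x : 0 < x -> 0 < flat m x.
Proof. by move=> x0; rewrite /flat x0 mulr_gt0 ?exprn_gt0 ?invr_gt0 ?expR_gt0. Qed.

Lemma flat_le0 m x : x <= 0 -> flat m x = 0.
Proof. by move=> x0; rewrite /flat ltNge x0. Qed.

Lemma flat_ge0 m x : 0 <= flat m x.
Proof. by have [/(flat_le0 m)->//|/(flat_gt0 m)/ltW] := leP x 0. Qed.

Lemma flat0_homo x y : x <= y -> flat 0 x <= flat 0 y.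
Proof.
move=> xy; have [/(flat_le0 0)->|x0] := leP x 0; first exact: flat_ge0.
have y0 := lt_le_trans x0 xy.
by rewrite /flat x0 y0 !expr0 !mul1r ler_expR lerN2 lef_pV2.
Qed.

(** Flatness at the origin: the exponential beats every power. *)
Lemma flat_le_sqr m x : flat m x <= (m.+2)`!%:R * x ^+ 2.
Proof.
have [x0|x0] := leP x 0.
  by rewrite flat_le0 // mulr_ge0 ?sqr_ge0 ?ler0n.
rewrite /flat x0 expRN; set y := x^-1; have y0 : 0 < y by rewrite invr_gt0.
rewrite ler_pdivrMr ?expR_gt0 //.
have -> : x = y^-1 by rewrite invrK.
have := expR_ge1Dxn m.+1 (ltW y0); set N := _%:R; have N0 : 0 < N by rewrite ltr0n fact_gt0.
move=> h; have {}h : y ^+ m.+2 / N <= expR y by lra.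
rewrite mulrAC; apply: (@le_trans _ _ (N * (y ^+ m.+2 / N) * y^-1 ^+ 2)).
  rewrite [N * _]mulrC divfK ?gt_eqF // -addn2 exprD -mulrA -exprMn divff ?gt_eqF //.
  by rewrite expr1n mulr1.
by rewrite ler_wpM2r ?sqr_ge0 // ler_wpM2l // ltW.
Qed.

Lemma is_derive_flat m (x : R) : is_derive x (1 : R) (flat m) (flat m.+2 x - m%:R * flat m.+1 x).
Proof.
have [x0|x0|->] := ltgtP x 0.
- rewrite !flat_le0 ?ltW // mulr0 subr0.
  apply: (@near_eq_is_derive _ _ _ (cst 0)) => //.
  by near=> y; rewrite flat_le0 // ltW //; near: y; exact: lt_nbhsl.
- have xn0 : x != 0 by rewrite gt_eqF.
  apply: (@near_eq_is_derive _ _ _ (fun y => y^-1 ^+ m * expR (- y^-1))).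
    near=> y; rewrite /flat ifT //; near: y; exact: lt_nbhsr.
  have dV : is_derive x 1 (fun y : R => y^-1) (- x ^- 2) .
    have := is_deriveV xn0 (is_derive_id x (1 : R)).
    by rewrite /GRing.scale /= mulr1.
  have dE : is_derive x 1 (fun y : R => expR (- y^-1)) (expR (- x^-1) * x ^- 2).
    have := is_deriveN dV; rewrite opprK => dNV.
    exact: (is_derive1_comp (is_derive_expR _) dNV).
  have dX : is_derive x 1 (fun y : R => y^-1 ^+ m) (m%:R * x^-1 ^+ m.-1 * - x ^- 2).
    by have := is_deriveX m dV; rewrite exprfctE.
  apply: (is_derive_eq (is_deriveM dX dE)).
  rewrite /flat x0 /GRing.scale /= -!exprVn; set y := x^-1.
  rewrite !exprS; case: m {dX} => [|m] /=; rewrite ?exprS ?mulr0n ?mul0r; ring.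
- rewrite !flat_le0 // mulr0 subr0.
  have cv : h^-1 *: (flat m (h *: 1 + 0) - flat m 0) @[h --> 0^'] --> (0 : R).
    apply/cvgr0Pnorm_lt => e e0.
    pose N : R := (m.+2)`!%:R; have N0 : 0 < N by rewrite ltr0n fact_gt0.
    near=> h.
    have h0 : h != 0 by near: h; exact: nbhs_dnbhs_neq.
    rewrite addr0 (flat_le0 m (lexx 0)) subr0 /GRing.scale /= mulr1.
    rewrite normrM normfV (ger0_norm (flat_ge0 _ _)).
    rewrite mulrC ltr_pdivrMr ?normr_gt0 //.
    rewrite (le_lt_trans (flat_le_sqr m h)) // -real_normK ?num_real // -/N expr2 mulrA.
    rewrite ltr_pM2r ?normr_gt0 // mulrC -ltr_pdivlMr //.
    near: h; apply: dnbhs0_lt; exact: divr_gt0.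
  apply: DeriveDef; first by apply/cvg_ex; exists 0.
  exact: cvg_lim cv.
Unshelve. all: by end_near.
Qed.

End Bump.

(** * Radial bumps and sums over a separated set *)

Section BumpOnSpace.
Context {R : realType} {n : nat}.
Local Notation V := 'rV[R]_n.
Implicit Types (x : V) (k m : nat).

(** The derivative of [flat m \o q] is a combination of [flat m.+1 \o q] and
    [flat m.+2 \o q] with the derivative of [q] as a factor, so the induction on
    [k] has to run over all [m] at once. *)
Lemma class_C_flat k m (q : V -> R) : class_C k q -> class_C k (fun x => flat m (q x)).
Proof.
elim: k m q => [m q cq x|k IH m q cq].
  apply: (continuous_comp (cq x)).
  apply: differentiable_continuous; apply/derivable1_diffP.
  by have [] := is_derive_flat m (q x).
have /class_CS[dq d2q] := cq.
have dflat (y : R) : differentiable (flat m) y.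
  by apply/derivable1_diffP; have [] := is_derive_flat m y.
split=> [x|v]; first by apply: (@differentiable_comp _ _ _ _ q (flat m)); [exact: dq|exact: dflat].
have -> : (fun x => 'd (fun y => flat m (q y)) x v)
    = (fun x => (flat m.+2 (q x) + - (m%:R * flat m.+1 (q x))) * 'd q x v).
  apply/funext => x.
  have := congr1 (fun g => g v) (@diff_comp _ _ _ _ q (flat m) x (dq x) (dflat (q x))).
  move=> h; apply: (etrans h); rewrite [LHS]/= diff1E // derive1E.
  by have [_ ->] := is_derive_flat m (q x); rewrite [LHS]mulrC.
apply: class_CM; last exact: d2q.
apply: class_CD; first exact/IH/class_CW.
by apply/class_CN/class_CM; [exact: class_C_cst|exact/IH/class_CW].
Qed.

Definition radial_bump (rho : R) x : R := flat 0 (rho ^+ 2 - \sum_j x 0 j ^+ 2).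

Lemma class_C_radial_bump k rho : class_C k (radial_bump rho).
Proof.
apply: class_C_flat; apply: class_CD; first exact: class_C_cst.
apply: class_CN; apply: class_C_sum => j.
by apply: class_CM; exact: class_C_coord.
Qed.

Lemma radial_bump_ge0 rho x : 0 <= radial_bump rho x.
Proof. exact: flat_ge0. Qed.

Lemma radial_bump_le0 rho x : radial_bump rho x <= radial_bump rho 0.
Proof.
apply: flat0_homo; rewrite lerD2l lerN2 big1 ?sum_sqr_ge0 // => j _.
by rewrite mxE expr0n.
Qed.

Lemma radial_bump_gt0 rho x : euclid_norm x < rho -> 0 < radial_bump rho x.
Proof.
move=> xrho; apply: flat_gt0; rewrite subr_gt0 -sqr_euclid_norm.
have x0 := euclid_norm_ge0 x.
by rewrite ltr_sqr ?nnegrE // ltW // (le_lt_trans x0).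
Qed.

Lemma radial_bump_eq0 (rho : R) x : 0 <= rho -> rho <= `|x| -> radial_bump rho x = 0.
Proof.
move=> rho0 rhox; apply: flat_le0; rewrite subr_le0 -sqr_euclid_norm.
rewrite ler_sqr ?nnegrE ?euclid_norm_ge0 //.
exact: le_trans (normr_le_euclid x).
Qed.

End BumpOnSpace.

Section LocalSums.
Context {R : realType} {n : nat}.
Local Notation V := 'rV[R]_n.
Variables (P : set V) (s K : R).
Hypotheses (s0 : 0 < s) (sep : forall p q, P p -> P q -> `|p - q| < s -> p = q).
Implicit Types (x y p q h : V).

Definition points_near x : set V := P `&` [set p | `|p - x| < K + 1].

Lemma finite_points_near x : finite_set (points_near x).
Proof.
apply: (@separated_bounded_finite _ _ _ s (K + 1 + `|x|) s0) => [p q [Pp _] [Pq _]|p [_ /= px]].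
  exact: sep.
by rewrite -[p](subrK x) (le_trans (ler_normD _ _)) // lerD2r ltW.
Qed.

(** On the unit ball around [x] the sum over [P] of kernels supported in a ball of
    radius [K] is one and the same finite sum. *)
Lemma local_sumE {W : zmodType} (F : V -> V -> W) x y :
  (forall p z, K <= `|z - p| -> F p z = 0) -> `|y - x| < 1 ->
  \sum_(p \in P) F p y = \sum_(p <- fset_set (points_near x)) F p y.
Proof.
move=> F0 yx; rewrite -fsbig_finite; last exact: finite_points_near.
apply/esym/fsbig_widen; first by move=> p [].
move=> p [Pp /not_andP[//|/=]] /negP; rewrite -leNgt => px.
apply: F0; have := ler_distD y p x; rewrite (distrC p y) => h; lra.
Qed.

Lemma class_C_local_sum {W : normedModType R} k (F : V -> V -> W) :
  (forall p z, K <= `|z - p| -> F p z = 0) -> (forall p, class_C k (F p)) ->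
  class_C k (fun y => \sum_(p \in P) F p y).
Proof.
move=> F0 cF; apply: class_C_local => x.
exists (fun y => \sum_(p <- fset_set (points_near x)) F p y); first exact: class_C_sum.
apply/nbhs_ballP; exists 1 => //= y; rewrite -ball_normE /= distrC => yx.
exact: local_sumE.
Qed.

Lemma points_near_agree x y : agree P (K + 1) x y ->
  points_near y = (fun p => p + (y - x)) @` points_near x.
Proof.
move=> xy; apply/seteqP; split=> [q [Pq /= qy]|_ [p [Pp /= px] <-]].
  exists (q - (y - x)); last by rewrite subrK.
  split; last by rewrite /= (_ : _ - x = q - y) //; vring.
  have -> : q - (y - x) = x + (q - y) by vring.
  by apply/xy => //; rewrite addrC subrK.
split; last by rewrite /= (_ : _ - y = p - x) //; vring.
have -> : p + (y - x) = y + (p - x) by vring.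
by apply/xy => //; rewrite addrC subrK.
Qed.

Lemma local_sum_agree {W : zmodType} (F : V -> V -> W) x y h :
  (forall p z, K <= `|z - p| -> F p z = 0) ->
  agree P (K + 1) x y -> `|h| < 1 ->
  \sum_(p \in P) F p (y + h)
  = \sum_(p <- fset_set (points_near x)) F (p + (y - x)) (y + h).
Proof.
move=> F0 xy h1; rewrite (@local_sumE _ _ y) //; last by rewrite addrAC subrr add0r.
rewrite -!fsbig_finite; try exact: finite_points_near.
rewrite (points_near_agree xy) fsbig_image // => p q _ _; exact: addIr.
Qed.

End LocalSums.

(** * Interpolation with local weights *)

Section Interpolation.
Context {R : realType} {n : nat}.
Local Notation V := 'rV[R]_n.
Variables (P : set V) (s r rho K : R).
Hypotheses (s0 : 0 < s) (sep : forall p q, P p -> P q -> `|p - q| < s -> p = q).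
Hypotheses (r0 : 0 < r) (near_point : forall x, exists2 p, P p & `|p - x| < r).
Hypotheses (r_rho : r <= rho) (rho_K : rho + s <= K).
Hypothesis r_ball : forall x : V, `|x| < r -> euclid_norm x < rho.
Implicit Types (x y z p q h : V).

Let radii : [/\ 0 < s, 0 < r, r <= rho & rho + s <= K]. Proof. by []. Qed.

Definition spike x : R := radial_bump (s / 2) x / radial_bump (s / 2) (0 : V).

Definition mass x : R := \sum_(p \in P) radial_bump rho (x - p).
Definition spikes x : R := \sum_(p \in P) spike (x - p).

(** A smooth partition of unity subordinate to the points of [P] and adapted to
    interpolation: at a point of [P] only the spike of that point counts. *)
Definition weight x p : R :=
  (1 - spikes x) * (mass x)^-1 * radial_bump rho (x - p) + spike (x - p).

Definition interpolation (f : V -> V) x : V := \sum_(p \in P) weight x p *: f p.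

Let radial_bump0_gt0 : 0 < radial_bump (s / 2) (0 : V).
Proof. by apply: radial_bump_gt0; rewrite euclid_norm0 divr_gt0. Qed.

Lemma spike_ge0 x : 0 <= spike x.
Proof. by rewrite divr_ge0 ?radial_bump_ge0. Qed.

Lemma spike_le1 x : spike x <= 1.
Proof. by rewrite ler_pdivrMr // mul1r radial_bump_le0. Qed.

Lemma spike_eq0 x : s / 2 <= `|x| -> spike x = 0.
Proof. by move=> sx; rewrite /spike radial_bump_eq0 ?mul0r // ltW // divr_gt0. Qed.

Let bump_supp p z : K <= `|z - p| -> radial_bump rho (z - p) = 0.
Proof.
by have [? ? ? ?] := radii => Kz; apply: radial_bump_eq0; [|apply: le_trans Kz]; lra.
Qed.

Let spikeK p z : K <= `|z - p| -> spike (z - p) = 0.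
Proof.
by have [? ? ? ?] := radii => Kz; apply: spike_eq0; apply: le_trans Kz; lra.
Qed.

Let weightK p z : K <= `|z - p| -> weight z p = 0.
Proof. by move=> Kz; rewrite /weight bump_supp // spikeK // mulr0 addr0. Qed.

Let near_seq x := fset_set (points_near P K x).

Let near_seqP x p : p \in near_seq x -> P p /\ `|p - x| < K + 1.
Proof.
rewrite in_fset_set; last exact: (finite_points_near K s0 sep x).
by move=> /set_mem[].
Qed.

Let massE x : mass x = \sum_(p <- near_seq x) radial_bump rho (x - p).
Proof. by apply: (local_sumE s0 sep bump_supp); rewrite subrr normr0. Qed.

Let spikesE x : spikes x = \sum_(p <- near_seq x) spike (x - p).
Proof. by apply: (local_sumE s0 sep spikeK); rewrite subrr normr0. Qed.

Let interpolationE f x :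
  interpolation f x = \sum_(p <- near_seq x) weight x p *: f p.
Proof.
apply: (local_sumE (F := fun p x => weight x p *: f p) s0 sep); last by rewrite subrr normr0.
by move=> p z /weightK ->; rewrite scale0r.
Qed.

Lemma mass_gt0 x : 0 < mass x.
Proof.
rewrite massE; have [p Pp px] := near_point x.
have pc : p \in near_seq x.
  rewrite in_fset_set; last exact: finite_points_near s0 sep x.
  by apply/mem_set; have [? ? ? ?] := radii; split => //=; lra.
rewrite (big_fsetD1 p pc) /= ltr_wpDr //.
  by apply: sumr_ge0 => q _; exact: radial_bump_ge0.
by apply/radial_bump_gt0/r_ball; rewrite distrC.
Qed.

Lemma spikes_at x p : P p -> `|x - p| < s / 2 -> spikes x = spike (x - p).
Proof.
move=> Pp xp; rewrite -[RHS](fsbig_set1 +%R p (fun q => spike (x - q))).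
apply/esym/fsbig_widen => [_ ->//|q [Pq /= qp]].
apply: spike_eq0; rewrite leNgt; apply/negP => xq; apply: qp.
by apply: sep => //; rewrite (le_lt_trans (ler_distD x _ _)) // distrC; have := s0; lra.
Qed.

Lemma spikes_le1 x : spikes x <= 1.
Proof.
have [[p Pp xp]|far] := pselect (exists2 p, P p & `|x - p| < s / 2).
  by rewrite (spikes_at Pp xp) spike_le1.
rewrite spikesE big_seq big1 // => p /near_seqP[Pp _]; apply: spike_eq0.
by rewrite leNgt; apply/negP => xp; apply: far; exists p.
Qed.

Lemma weight_ge0 x p : 0 <= weight x p.
Proof.
rewrite addr_ge0 ?spike_ge0 // !mulr_ge0 ?radial_bump_ge0 ?subr_ge0 ?spikes_le1 //.
by rewrite invr_ge0 ltW ?mass_gt0.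
Qed.

Let sum_weight x : \sum_(p <- near_seq x) weight x p = 1.
Proof.
rewrite big_split /= -mulr_sumr -massE -spikesE -mulrA mulVf ?mulr1 ?subrK //.
by rewrite gt_eqF ?mass_gt0.
Qed.

Lemma smooth_interpolation f : smooth (interpolation f).
Proof.
move=> k; apply: (class_C_local_sum (F := fun p x => weight x p *: f p) s0 sep).
  by move=> p z /weightK ->; rewrite scale0r.
have cb rho' p : class_C k (fun x => radial_bump rho' (x - p)).
  exact: (class_C_shift (- p) (class_C_radial_bump k rho')).
have cs p : class_C k (fun x => spike (x - p)).
  by apply: class_CM; [exact: cb|exact: class_C_cst].
move=> p; apply: class_CZl; apply: class_CD => //; apply: class_CM => //.
apply: class_CM.
  apply: class_CD; first exact: class_C_cst.
  by apply: class_CN; exact: (class_C_local_sum s0 sep spikeK).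
apply: class_CV; first by move=> x; rewrite gt_eqF ?mass_gt0.
exact: (class_C_local_sum s0 sep bump_supp).
Qed.

Lemma interpolation_point f p : P p -> interpolation f p = f p.
Proof.
move=> Pp; have sp0 : spike (p - p) = 1.
  by rewrite subrr /spike divff // gt_eqF.
have sp1 : spikes p = 1 by rewrite (spikes_at Pp) // subrr normr0 divr_gt0.
have wE q : weight p q = spike (p - q).
  by rewrite /weight sp1 subrr !mul0r add0r.
rewrite -[RHS]scale1r -sp0 -[RHS](fsbig_set1 +%R p (fun q => spike (p - q) *: f q)).
have -> : interpolation f p = \sum_(q \in P) spike (p - q) *: f q.
  by apply: eq_fsbigr => q _; rewrite wE.
apply/esym/fsbig_widen => [_ ->//|q [Pq /= qp]].
rewrite spike_eq0 ?scale0r // leNgt; apply/negP => pq; apply: qp.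
by apply: sep => //; rewrite distrC; have := s0; lra.
Qed.

(** A weighted mean stays close to [f x] when all the values it averages do. *)
Lemma interpolation_near f (M : R) :
  (forall x y, `|x - y| < K + 1 -> `|f x - f y| <= M) ->
  forall x, `|interpolation f x - f x| <= M.
Proof.
move=> fM x; rewrite interpolationE -[f x]scale1r -(sum_weight x) scaler_suml -sumrB.
rewrite (le_trans (ler_norm_sum _ _ _)) // -[leRHS]mul1r -(sum_weight x) mulr_suml.
rewrite big_seq [leRHS]big_seq; apply: ler_sum => p /near_seqP[Pp px].
by rewrite -scalerBr normrZ ger0_norm ?weight_ge0 // ler_wpM2l ?weight_ge0 ?fM.
Qed.

(** The weights depend on the pattern around [x] only, and sum to [1]: where two
    patches agree and [f] differs between them by a constant vector, the same
    holds for the interpolations. *)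
Lemma interpolation_agree f x y (c : V) : agree P (K + 1) x y ->
  (forall p, P p -> `|p - x| < K + 1 -> f (p + (y - x)) = f p + c) ->
  forall h, `|h| < 1 -> interpolation f (y + h) = interpolation f (x + h) + c.
Proof.
move=> xy fc h h1.
have shift p : y + h - (p + (y - x)) = x + h - p by vring.
have sumE (F : V -> R) : (forall p z, K <= `|z - p| -> F (z - p) = 0) ->
    \sum_(p \in P) F (y + h - p) = \sum_(p \in P) F (x + h - p).
  move=> F0; rewrite (local_sum_agree s0 sep F0 xy h1).
  rewrite (local_sumE (F := fun p z => F (z - p)) s0 sep F0 (x := x)); last first.
    by rewrite addrAC subrr add0r.
  by apply: eq_bigr => p _; rewrite shift.
have massS : mass (y + h) = mass (x + h) := sumE (radial_bump rho) bump_supp.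
have spikesS : spikes (y + h) = spikes (x + h) := sumE spike spikeK.
have wE p : weight (y + h) (p + (y - x)) = weight (x + h) p.
  by rewrite /weight massS spikesS shift.
have w0 p z : K <= `|z - p| -> weight z p *: f p = 0 :> V.
  by move=> /weightK ->; rewrite scale0r.
have xhx : `|x + h - x| < 1 by rewrite addrAC subrr add0r.
have yE : interpolation f (y + h)
    = \sum_(p <- near_seq x) weight (y + h) (p + (y - x)) *: f (p + (y - x)).
  exact: (local_sum_agree (F := fun p z => weight z p *: f p) s0 sep w0 xy h1).
have xE : interpolation f (x + h) = \sum_(p <- near_seq x) weight (x + h) p *: f p.
  exact: (local_sumE (F := fun p z => weight z p *: f p) s0 sep w0 xhx).
rewrite yE xE.
have -> : c = \sum_(p <- near_seq x) weight (x + h) p *: c.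
  rewrite -scaler_suml.
  suff -> : \sum_(p <- near_seq x) weight (x + h) p = 1 by rewrite scale1r.
  have <- := local_sumE (F := fun p z => weight z p) s0 sep weightK xhx.
  rewrite -(sum_weight (x + h)).
  by apply: (local_sumE (F := fun p z => weight z p) s0 sep weightK); rewrite subrr normr0.
rewrite -big_split big_seq [RHS]big_seq; apply: eq_bigr => p /near_seqP[Pp px].
by rewrite wE fc // scalerDr.
Qed.

(** If the patches at [x] and [y] agree, the displacement of [f] from [p] to
    [p + (y - x)] is the same vector for all points [p] of the pattern near [x].
    The interpolation changes by this constant, and its differential not at all. *)
Lemma interpolation_equivariant f :
  (forall rho' : R, exists r', forall p p1 v, P p -> P p1 -> agree P r' p p1 ->
     `|v| < rho' -> P (p + v) -> P (p1 + v) -> f (p + v) - f p = f (p1 + v) - f p1) ->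
  strongly_equivariant P (fun x => 'd (interpolation f) x : V -> V).
Proof.
move=> /(_ (K + 1 + r))[r' fr'].
exists (n.+1%:R * (`|r'| + r + K + 1)) => x y xy_patch.
have {xy_patch} xy := patch_agree xy_patch.
have [s_gt0 r_gt0 r_le rho_le] := radii.
have [p Pp px] := near_point x.
have K0 : 0 < K by lra.
have xyK : agree P (K + 1) x y by apply: agree_le xy; have := normr_ge0 r'; lra.
have p1E : y + (p - x) = p + (y - x) by vring.
have Pp1 : P (p + (y - x)).
  rewrite -p1E; apply/xyK; last by rewrite addrC subrK.
  by lra.
have pp1 : agree P r' p (p + (y - x)).
  rewrite -p1E -{1}[p](subrK x) [p - x + x]addrC.
  apply: (@agree_shift _ _ _ _ r); last exact: ltW.
  by apply: agree_le xy; have := ler_norm r'; lra.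
(* by locality this vector does not depend on the choice of [p] *)
pose c := f (p + (y - x)) - f p.
have fc q : P q -> `|q - x| < K + 1 -> f (q + (y - x)) = f q + c.
  move=> Pq qx; have Pq1 : P (q + (y - x)).
    have -> : q + (y - x) = y + (q - x) by vring.
    by apply/xyK => //; rewrite addrC subrK.
  have qE : p + (q - p) = q by rewrite addrC subrK.
  have q1E : p + (y - x) + (q - p) = q + (y - x) by vring.
  have := fr' p (p + (y - x)) (q - p) Pp Pp1 pp1; rewrite qE q1E => fq.
  have {}fq : f q - f p = f (q + (y - x)) - f (p + (y - x)).
    apply: fq => //; have -> : q - p = (q - x) - (p - x) by vring.
    by rewrite (le_lt_trans (ler_normB _ _)) //; lra.
  by rewrite /c [RHS]addrCA fq [RHS]addrC subrK.
have shiftE := interpolation_agree xyK fc.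
have /class_CS[dphi _] := @smooth_interpolation f 1.
have yE : x + (y - x) = y by rewrite addrC subrK.
have := @diff_near_shift _ _ _ (interpolation f) (y - x) x c (dphi _).
rewrite yE; apply.
apply/nbhs_ballP; exists 1 => //= z; rewrite -ball_normE /= distrC => zx.
have := shiftE (z - x) zx; rewrite [x + _]addrC subrK => <-.
by congr interpolation; vring.
Qed.

End Interpolation.

(** * The interpolated cocycle *)

Theorem corollary4p11 (R : realType) (n : nat) (P P' : set 'rV[R]_n)
  (P_Delone : Delone P) (P_flc : finite_local_complexity P)
  (P_aper : aperiodic P)
  (P'_Delone : Delone P') (P'_flc : finite_local_complexity P')
  (P'_aper : aperiodic P')
  (Om Om' : metricType R)
  (i : set 'rV[R]_n -> Om) (i' : set 'rV[R]_n -> Om')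
  (Om_hull : is_hull P i) (Om'_hull : is_hull P' i')
  (Phi : Om -> Om')
  (Phi_homeo : homeomorphism Phi)
  (Phi_transversal :
    Phi @` transversal_of P i = transversal_of P' i')
  (Phi_P : Phi (i P) = i' P')
  (phiP : 'rV[R]_n -> 'rV[R]_n)
  (phiP_def : forall x, Phi (i (translate P x)) = i' (translate P' (phiP x))) :
  exists phi : 'rV[R]_n -> 'rV[R]_n,
    [/\ smooth phi,
        strongly_equivariant P
          (fun x => ('d phi x : 'rV[R]_n -> 'rV[R]_n)),
        (forall p, P p -> phi p = phiP p),
        phi @` P = P' &
        forall r : R, 0 < r -> exists2 r' : R, 0 < r' &
          forall x, euclid_ball (phi x) r `&` phi @` P
                    `<=` phi @` (euclid_ball x r' `&` P)].
Proof.
have [Phi_cont _] := Phi_homeo.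
have points := hull_cocycle_points P'_Delone Om'_hull phiP_def Phi_transversal.
have image := hull_cocycle_image P_Delone P_flc P'_Delone P'_flc Om_hull Om'_hull
  P_aper P'_aper Phi_homeo Phi_P phiP_def Phi_transversal.
have [g [fK gK g_coarse]] := hull_cocycle_inverse P_Delone P_flc P'_Delone P'_flc
  Om_hull Om'_hull P_aper P'_aper Phi_homeo Phi_P phiP_def.
have local := hull_cocycle_local P_Delone P_flc P'_Delone P'_flc Om_hull Om'_hull
  Phi_cont P'_aper phiP_def points.
have coarse := hull_cocycle_coarse P_Delone P_flc P'_Delone P'_flc Om_hull Om'_hull
  Phi_cont P'_aper phiP_def.
have [s s0 sep] := uniformly_discrete_sep (proj1 P_Delone).
have [r0 r0_gt0 near] := relatively_dense_near (proj2 P_Delone).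
(* bumps of Euclidean radius [rho] around the points of [P] cover the space *)
pose rho : R := n.+1%:R * r0; pose K := rho + s.
have r_rho : r0 <= rho by rewrite ler_peMl ?ler1n // ltW.
have rho_K : rho + s <= K by [].
have r_ball (x : 'rV[R]_n) : `|x| < r0 -> euclid_norm x < rho.
  move=> xr; rewrite (le_lt_trans (euclid_le_normr x)) //.
  by rewrite ltr_pM2l ?ltr0n.
(* bounds the variation of [phiP] over the support of the weights *)
have [M fM] := coarse (K + 1).
have phi_near := interpolation_near s0 sep r0_gt0 near r_rho rho_K r_ball fM.
pose phi := interpolation P s rho phiP.
have phi_point p : P p -> phi p = phiP p by exact: interpolation_point.
have phi_image : phi @` P = P'.
  by rewrite -image; apply: eq_imagel.
exists phi; split=> //.
- exact: (smooth_interpolation s0 sep r0_gt0 near r_rho rho_K r_ball).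
- exact: (interpolation_equivariant s0 sep r0_gt0 near r_rho rho_K r_ball).
move=> r r_gt0; have [M' gM] := g_coarse (r + M).
exists (n.+1%:R * `|M'| + 1) => [|x y [yx [p Pp py]]].
  by rewrite ltr_wpDl // mulr_ge0 ?ler0n.
exists p => //; split=> //; rewrite /euclid_ball /=.
have : `|g (phiP p) - g (phiP x)| <= M'.
  apply: gM; have -> : phiP p - phiP x = (y - phi x) + (phi x - phiP x).
    by rewrite -py phi_point // addrA subrK.
  rewrite (le_lt_trans (ler_normD _ _)) // ltr_leD //.
  exact: le_lt_trans (normr_le_euclid _) yx.
rewrite !fK => h; rewrite (le_lt_trans (euclid_le_normr _)) // ltr_pwDr //.
by rewrite ler_wpM2l ?ler0n // (le_trans h) // ler_norm.
Qed.
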